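(* Let $k\ge r\ge 3$ and $m\ge 0$ be integers. There is a bijection $\Phi_m\colon\mathbb{C}_{<}(k,r|m)\to\mathbb{C}_{=}(k,r|m)$ such that for every $\pi\in\mathbb{C}_{<}(k,r|m)$ the partition $\omega=\Phi_m(\pi)$ satisfies $|\omega|=|\pi|+2m+1$ and $\ell(\omega)=\ell(\pi)+1$.
   Context: A partition $\pi=(\pi_1,\dots,\pi_\ell)$ is a finite non-increasing sequence of positive integers; $\ell(\pi)$ is its number of parts, $|\pi|$ its sum; ''$a$ occurs in $\pi$'' means $a=\pi_i$ for some $i$. Göllnitz–Gordon marking: $GG(\pi)$ assigns a positive integer (mark) to each part, processing the parts from smallest to largest; $\pi_i$ receives the smallest positive integer different from the marks of all parts $\pi_g$ with $g>i$ and $\pi_i-\pi_g\le 2$, where $\pi_i-\pi_g<2$ is required when $\pi_i$ is odd. An ''$r$-marked part $a$'' is a part equal to $a$ with mark $r$. $N_i(\pi)$ is the number of parts with mark $i$; $\pi^{(i)}_1\ge\dots\ge\pi^{(i)}_{N_i(\pi)}$ are the parts with mark $i$, with $\pi^{(i)}_0=+\infty$, $\pi^{(i)}_{N_i(\pi)+1}=-\infty$. $\mathbb{C}(k,r)$: partitions with (i) no odd part repeated; (ii) $\pi_i\ge\pi_{i+k-1}+2$ for $1\le i\le\ell-k+1$, strict if $\pi_i$ even; (iii) at most $r-1$ parts $\le 2$. Starting types: for $\pi\in\mathbb{C}(k,r)$ with $N_2=N_2(\pi)\ge1$, let $l$ be the largest integer in $\{0,\dots,N_2\}$ such that no odd part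 of $\pi$ is $\ge\pi^{(2)}_l$; for $l<i\le N_2$, $\pi^{(2)}_i$ has type $s_{-1}$. For $b=1,\dots,l$ in increasing order, type and auxiliary $\sigma_b$: for $b=1$: Case 1: 1-marked part $\pi^{(2)}_1-1$ exists and $\pi^{(2)}_1+2$ does not occur: type $s_0$, $\sigma_1=\pi^{(2)}_1-1$; Case 2: 1-marked $\pi^{(2)}_1-2$ exists and $\pi^{(2)}_1+2$ does not occur: type $s_1$, $\sigma_1=\pi^{(2)}_1-2$; Case 3: 1-marked $\pi^{(2)}_1+2$ exists: type $s_2$, $\sigma_1=\pi^{(2)}_1+2$; Case 4: 1-marked $\pi^{(2)}_1$ exists: type $s_3$, $\sigma_1=\pi^{(2)}_1$. For $2\le b\le l$: Case 1: 1-marked $\pi^{(2)}_b-1$ exists and, if a 1-marked $\pi^{(2)}_b+2$ exists, $\sigma_{b-1}=\pi^{(2)}_b+2$: type $s_0$, $\sigma_b=\pi^{(2)}_b-1$; Case 2: same with $\pi^{(2)}_b-2$: type $s_1$, $\sigma_b=\pi^{(2)}_b-2$; Case 3: 1-marked $\pi^{(2)}_b+2$ exists and $\sigma_{b-1}\ne\pi^{(2)}_b+2$: type $s_2$, $\sigma_b=\pi^{(2)}_b+2$; Case 4: 1-marked $\pi^{(2)}_b$ exists: type $s_3$, $\sigma_b=\pi^{(2)}_b$. $\mathbb{C}_{<}(k,r|p,t)$ (for $p,t\ge0$): the set of $\pi\in\mathbb{C}(k,r)$ such that (1) no odd part is $\ge 2t+1$; (2) $\pi^{(2)}_{p+1}<2t+1<\pi^{(2)}_p$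 (in particular $p\le N_2(\pi)$); (3) if $\pi^{(2)}_p=2t+2$ then it is of starting type $s_2$ or $s_3$; (4) if $\pi^{(2)}_{p+1}=2t$ then it is of starting type $s_0$ or $s_1$. $\mathbb{C}_{=}(k,r|p,t)$ (for $p,t\ge0$): the set of $\pi\in\mathbb{C}(k,r)$ such that (1) the largest odd part is $2t+1$; (2) the mark of $2t+1$ in $GG(\pi)$ is at most $2$; (3) $\pi^{(2)}_p\ge 2t+2$ and $\pi^{(2)}_{p+1}\le 2t+2$; (4) if there is a 2-marked part $2t+2$ of starting type $s_0$, then $\pi^{(2)}_{p+1}=2t+2$ and there exists $1\le i\le p+1$ with $\pi^{(2)}_i=\pi^{(2)}_{p+1}+4(p-i+1)$ and $\pi^{(2)}_i$ occurring exactly once in $\pi$; (5) if there is a 2-marked part $2t+2$ of starting type $s_2$, then $\pi^{(2)}_p=2t+2$; (6) if $2t+2$ occurs in $\pi$ and there is no 2-marked part $2t+2$, then $\pi^{(2)}_p=2t+4$, it is of starting type $s_3$, and there exists $1\le i\le p$ with $\pi^{(2)}_i=\pi^{(2)}_p+4(p-i)$ such that $\pi^{(2)}_i+2$ does not occur in $\pi$. For $m\ge0$: $\mathbb{C}_{<}(k,r|m)=\bigcup_{p+t=m}\mathbb{C}_{<}(k,r|p,t)$ and $\mathbb{C}_{=}(k,r|m)=\bigcup_{p+t=m}\mathbb{C}_{=}(k,r|p,t)$, unions over integers $p,t\ge0$. *)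

(* Defs.v *)
From mathcomp Require Import all_boot.
Set Implicit Arguments. Unset Strict Implicit. Unset Printing Implicit Defensive.

(* A partition: non-increasing sequence of positive integers
   (pi_1 >= ... >= pi_l), stored in this order (index i of the paper
   is position i-1 of the list). *)
Definition is_partition (pi : seq nat) : bool :=
  sorted geq pi && all (fun x => 0 < x) pi.

Definition mex_pos (S : seq nat) : nat :=
  (find (fun n => n.+1 \notin S) (iota 0 (size S).+1)).+1.

(* Goellnitz-Gordon marking.  gg (x :: t) : the marks of the parts
   x :: t.  Parts of t are the pi_g with g > i (the smaller parts,
   processed first); x receives the smallest positive integer different
   from the marks of the parts y of t with x - y <= 2 (x - y < 2 if x odd). *)
Fixpoint gg (pi : seq nat) : seq nat :=
  match pi with
  | [::] => [::]
  | x :: t =>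
      let mt := gg t in
      let close y := if odd x then x < y + 2 else x <= y + 2 in
      mex_pos [seq q.2 | q <- zip t mt & close q.1] :: mt
  end.

Definition marked (i : nat) (pi : seq nat) : seq nat :=
  [seq q.1 | q <- zip pi (gg pi) & q.2 == i].

Definition Nm (i : nat) (pi : seq nat) : nat := size (marked i pi).

Definition has_marked (i a : nat) (pi : seq nat) : bool := a \in marked i pi.

Inductive ext := NInf | Fin of nat | PInf.

Definition pmark (i : nat) (pi : seq nat) (j : nat) : ext :=
  if j == 0 then PInf
  else if j <= Nm i pi then Fin (nth 0 (marked i pi) j.-1) else NInf.

Definition ext_lt_nat (e : ext) (a : nat) : Prop :=
  match e with NInf => True | Fin x => x < a | PInf => False end.
Definition ext_le_nat (e : ext) (a : nat) : Prop :=
  match e with NInf => True | Fin x => x <= a | PInf => False end.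
Definition nat_lt_ext (a : nat) (e : ext) : Prop :=
  match e with NInf => False | Fin x => a < x | PInf => True end.
Definition nat_le_ext (a : nat) (e : ext) : Prop :=
  match e with NInf => False | Fin x => a <= x | PInf => True end.

Definition inC (k r : nat) (pi : seq nat) : Prop :=
  is_partition pi /\
  (forall x, odd x -> count_mem x pi <= 1) /\
  (forall i, i + k - 1 < size pi ->
     if odd (nth 0 pi i) then nth 0 pi i >= nth 0 pi (i + k - 1) + 2
     else nth 0 pi i > nth 0 pi (i + k - 1) + 2) /\
  count (fun x => x <= 2) pi <= r - 1.

Inductive stype := s_m1 | s_0 | s_1 | s_2 | s_3 | s_none.
(* s_none is only a fallback value in case none of the four cases applies *)

Definition no_odd_ge (pi : seq nat) (j : nat) : bool :=
  if j == 0 then true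
  else all (fun x => odd x ==> (x < nth 0 (marked 2 pi) j.-1)) pi.

Definition lstart (pi : seq nat) : nat :=
  \max_(j < (Nm 2 pi).+1 | no_odd_ge pi j) j.

(* (type, sigma_b) of the b-th 2-marked part, computed by the case rules
   for b = 1, 2, ... (meaningful for 1 <= b <= l) *)
Fixpoint st_sigma (pi : seq nat) (b : nat) : stype * option nat :=
  match b with
  | 0 => (s_none, None)
  | b'.+1 =>
    let x := nth 0 (marked 2 pi) b' in
    let one a := has_marked 1 a pi in
    if b' == 0 then
      if one (x - 1) && (x + 2 \notin pi) then (s_0, Some (x - 1))
      else if one (x - 2) && (x + 2 \notin pi) then (s_1, Some (x - 2))
      else if one (x + 2) then (s_2, Some (x + 2))
      else if one x then (s_3, Some x)
      else (s_none, None)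
    else
      let prev := (st_sigma pi b').2 in
      if one (x - 1) && (one (x + 2) ==> (prev == Some (x + 2)))
        then (s_0, Some (x - 1))
      else if one (x - 2) && (one (x + 2) ==> (prev == Some (x + 2)))
        then (s_1, Some (x - 2))
      else if one (x + 2) && (prev != Some (x + 2)) then (s_2, Some (x + 2))
      else if one x then (s_3, Some x)
      else (s_none, None)
  end.

Definition start_type (pi : seq nat) (b : nat) : stype :=
  if (0 < b) && (b <= lstart pi) then (st_sigma pi b).1
  else if (lstart pi < b) && (b <= Nm 2 pi) then s_m1
  else s_none.

Definition has_type (pi : seq nat) (j : nat) (s : stype) : Prop :=
  0 < j <= Nm 2 pi /\ start_type pi j = s.

Definition Cless (k r p t : nat) (pi : seq nat) : Prop :=
  inC k r pi /\
  (forall x, x \in pi -> odd x -> x < 2 * t + 1) /\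
  (ext_lt_nat (pmark 2 pi p.+1) (2 * t + 1) /\
   nat_lt_ext (2 * t + 1) (pmark 2 pi p)) /\
  (pmark 2 pi p = Fin (2 * t + 2) ->
     has_type pi p s_2 \/ has_type pi p s_3) /\
  (pmark 2 pi p.+1 = Fin (2 * t) ->
     has_type pi p.+1 s_0 \/ has_type pi p.+1 s_1).

Definition marked2_of_type (pi : seq nat) (a : nat) (s : stype) : Prop :=
  exists b, pmark 2 pi b = Fin a /\ has_type pi b s.

Definition Ceq (k r p t : nat) (pi : seq nat) : Prop :=
  let L2 := marked 2 pi in
  inC k r pi /\
  ((2 * t + 1) \in pi /\ (forall x, x \in pi -> odd x -> x <= 2 * t + 1)) /\
  (forall j, j < size pi -> nth 0 pi j = 2 * t + 1 -> nth 0 (gg pi) j <= 2) /\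
  (nat_le_ext (2 * t + 2) (pmark 2 pi p) /\
   ext_le_nat (pmark 2 pi p.+1) (2 * t + 2)) /\
  (marked2_of_type pi (2 * t + 2) s_0 ->
     pmark 2 pi p.+1 = Fin (2 * t + 2) /\
     exists i, 1 <= i <= p.+1 /\
       nth 0 L2 i.-1 = nth 0 L2 p + 4 * (p.+1 - i) /\
       count_mem (nth 0 L2 i.-1) pi = 1) /\
  (marked2_of_type pi (2 * t + 2) s_2 -> pmark 2 pi p = Fin (2 * t + 2)) /\
  ((2 * t + 2) \in pi -> (2 * t + 2) \notin L2 ->
     pmark 2 pi p = Fin (2 * t + 4) /\ has_type pi p s_3 /\
     exists i, 1 <= i <= p /\
       nth 0 L2 i.-1 = nth 0 L2 p.-1 + 4 * (p - i) /\
       (nth 0 L2 i.-1 + 2) \notin pi).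

Definition Cless_m (k r m : nat) (pi : seq nat) : Prop :=
  exists p t, p + t = m /\ Cless k r p t pi.
Definition Ceq_m (k r m : nat) (pi : seq nat) : Prop :=
  exists p t, p + t = m /\ Ceq k r p t pi.

(* Main.v *)
From Stdlib Require Import ClassicalEpsilon.
Require Import Defs.
From mathcomp Require Import all_boot.
From mathcomp Require Import zify.
Set Implicit Arguments. Unset Strict Implicit. Unset Printing Implicit Defensive.

(** The map leaves the parts at most 2t alone. Above 2t all parts of pi are
even, so they amount to a sequence s of multiplicities (s_0 copies of 2t+2, s_1
copies of 2t+4, ...), and whether a part carries mark 1 or 2 is decided by a
finite automaton reading s upwards. When 2t carries mark 1 or 2 (it never
carries both), the conditions on starting types in C_<(p,t) say that the initial
run of nonzero entries of s has even length, and those in C_=(p,t) that it is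
[thick false]; otherwise the former are void and the latter say that the run is
not [thick true]. In all cases p is the number of 2-marked parts obtained by
reading s as if nothing lay below it. The bijection between the two families of
sequences (the relation [shift]) reads s upwards and, for each 2-marked part,
moves one part to the next level: this adds 2p to the partition, and inserting
the part 2t+1 adds the rest. *)

(** Marks are assigned from the smallest part upwards, starting types from the largest part
    downwards. The two meet because, above a 2-marked part with no 1-marked copy, the marks 1 and 2
    alternate along a run of nonzero levels, so that the type at its bottom depends only on a
    parity. That 2t never carries both marks has two sources: in C_< it would have type s_3, against
    condition (4); in C_= the part 2t+1 would get mark at least 3, against condition (2). [shift] is
    a relation because its rules need look-ahead: rules with inputs of the same shape are told apart
    by [evenrun] of the remainder, rules with outputs of the same shape by [thick]. Thickness also
    decides whether there is room: the size conditions say that at most k-1 parts lie in each window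
    2a, 2a+1, 2a+2, and thickness excludes the extremal sequences for which the inserted part 2t+1
    would make a difference further up. *)

(** * Moving parts in a sequence of multiplicities *)

(* The flag [true] restricts to sequences whose initial nonzero run is even;
   it is set when 2t carries mark 1 or 2. *)
Inductive shift : bool -> seq nat -> seq nat -> Prop :=
| shift_nil e : shift e [::] [::]
| shift_zero e s s' : shift false s s' -> shift e (0 :: s) (0 :: s')
| shift_one s s' : shift true s s' -> shift false (1 :: s) (1 :: s')
| shift_one_pair h s s' :
    shift true s s' -> shift false [:: 1, h.+1 & s] [:: 0, h.+2 & s']
| shift_pair h g s s' :
    shift false s s' -> shift false [:: h.+2, g & s] [:: h.+1, g.+1 & s']
| shift_even_pair h g s s' :
    shift true s s' -> shift true [:: h.+1, g.+1 & s] [:: h, g.+2 & s'].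

Fixpoint evenrun (s : seq nat) : bool :=
  if s is h :: s' then (h == 0) || ~~ evenrun s' else true.

(* [thick true s]: the initial run of nonzero entries has odd length and the
   entries at its odd positions (counted from 1) are at least 2.  [thick false s]:
   it has even length and those at its even positions are at least 2. *)
Fixpoint thick (odd_pos : bool) (s : seq nat) : bool :=
  if s is h :: s' then
    if odd_pos then (2 <= h) && thick false s' else (h == 0) || thick true s'
  else ~~ odd_pos.

(** With K = k-1 this is the window bound on the levels above 2t; [d] is the room that the parts
    below leave to the first level. *)
Fixpoint cap (K d : nat) (s : seq nat) : bool :=
  if s is h :: s' then (h <= d) && cap K (K - h) s' else true.

(* Does a level holding [h] equal even parts receive mark 1 (resp. 2), when
   [b1], [b2] tell whether marks 1, 2 are forbidden by the parts just below? *)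
Definition mark1 (b1 : bool) (h : nat) : bool := ~~ b1 && (h != 0).
Definition mark2 (b1 b2 : bool) (h : nat) : bool :=
  ~~ b2 && (if b1 then h != 0 else h.-1 != 0).

Fixpoint num2 (b1 b2 : bool) (s : seq nat) : nat :=
  if s is h :: s' then mark2 b1 b2 h + num2 (mark1 b1 h) (mark2 b1 b2 h) s'
  else 0.

Fixpoint weight (a : nat) (s : seq nat) : nat :=
  if s is h :: s' then a * h + weight a.+1 s' else 0.

Lemma thick_evenrun o s : thick o s -> evenrun s = ~~ o.
Proof.
elim: s o => [|h s IH] [] //=; first by case/andP; case: h => // h _ /IH ->.
by case: h => //= h /IH ->.
Qed.

Lemma shift_evenrun e s s' : shift e s s' -> e -> evenrun s.
Proof. by elim=> //= h g {}s {}s' _ IH /IH ->. Qed.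

(** Half of the description of the image; the other half is [shift_onto]. *)
Lemma shift_thick e s s' : shift e s s' -> thick (~~ e) s' = e.
Proof.
elim=> {e s s'} [[]|[]|s s' _ H|h s s' _ H|h g s s' _ H|h g s s' _ H] //=.
- by move: H => /= ->; rewrite andbF.
- by move: H => /= ->; rewrite orbT.
Qed.

Lemma shift_inj e s s' : shift e s s' -> forall r, shift e r s' -> s = r.
Proof.
(* [clash1] separates [shift_zero] from the two pair rules whose output begins with 0, and [clash2]
   separates [shift_one] from [shift_pair]. *)
have clash1 h r r' t : shift true r r' -> shift false t (h.+2 :: r') -> False.
  by move=> /shift_thick /= Hr /shift_thick /=; rewrite Hr.
have clash2 h r r' t : shift false r r' -> shift true t (h.+1 :: r') -> False.
  by move=> /shift_thick /= Hr /shift_thick /=; rewrite Hr.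
elim=> {e s s'} [e|e s s' H IH|s s' H IH|h s s' H IH|h g s s' H IH|h g s s' H IH] r Hr;
  inversion Hr; subst; try by [| do ?congr (_ :: _); auto]; exfalso; eauto.
Qed.

Lemma shift_fun e s s' : shift e s s' -> forall r, shift e s r -> s' = r.
Proof.
have clash h r r' t : shift true r r' -> shift true (h.+1 :: r) t -> False.
  by move=> /shift_evenrun /(_ isT) Hr /shift_evenrun /(_ isT) /=; rewrite Hr.
elim=> {e s s'} [e|e s s' H IH|s s' H IH|h s s' H IH|h g s s' H IH|h g s s' H IH] r Hr;
  inversion Hr; subst; try by [| do ?congr (_ :: _); auto]; exfalso; eauto.
Qed.

(** The appended 0 is an empty level into which a part of the topmost level can move. *)
Lemma shift_total e s : e ==> evenrun s -> exists s', shift e (rcons s 0) s'.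
Proof.
elim: {s}(size s) {-2}s e (leqnn (size s)) => [|n IH] [|h s] e //= Hs He;
  try by exists [:: 0]; do 2!constructor.
have {}He : e -> (h == 0) || ~~ evenrun s by apply/implyP.
case: h He => [|h] /= He.
  by case: (IH s false) => // s' ?; exists (0 :: s'); constructor.
case: e He => [|_].
  move=> /(_ isT); case: s Hs => [|[|g] s] //= Hs; rewrite negbK => es.
  case: (IH s true) => //; first exact: ltnW.
  by move=> s' ?; exists [:: h, g.+2 & s']; constructor.
case: h => [|h].
  case es: (evenrun s).
    by case: (IH s true) => // s' ?; exists (1 :: s'); constructor.
  case: s Hs es => [|[|g] s] //= Hs /negbFE es.
  case: (IH s true) => //; first exact: ltnW.
  by move=> s' ?; exists [:: 0, g.+2 & s']; constructor.
case: s Hs => [|g s] /= Hs.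
  by exists [:: h.+1; 1]; do 2!constructor.
case: (IH s false) => //; first exact: ltnW.
by move=> s' ?; exists [:: h.+1, g.+1 & s']; constructor.
Qed.

Lemma shift_onto e s' : thick (~~ e) s' = e -> exists s, shift e s s'.
Proof.
elim: {s'}(size s') {-2}s' e (leqnn (size s')) => [|n IH] [|h s] e //= Hs;
  try by exists [::]; constructor.
have L (H : (h == 0)) : exists r, shift e r (h :: s).
  rewrite (eqP H); case Gs: (thick true s); last first.
    by case: (IH s false) => // r ?; exists (0 :: r); constructor.
  case: s Hs Gs => [|[|[|g]] s] //= Hs Gs.
  case: (IH s true) => //; first exact: ltnW.
  by move=> r ?; exists [:: 1, g.+1 & r]; case: (e); constructor.
case: h L => [|h] L; first by move=> _; apply: L.
case: e {L} => /=.
  case: s Hs => [|[|[|g]] s] //= Hs Fs.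
  case: (IH s true) => //; first exact: ltnW.
  by move=> r ?; exists [:: h.+2, g.+1 & r]; constructor.
have M : ~~ thick false s -> exists r, shift false r (h.+1 :: s).
  case: s Hs => [|[|g] s] //= Hs /negbTE Gs.
  case: (IH s false) => //; first exact: ltnW.
  by move=> r ?; exists [:: h.+2, g & r]; constructor.
case: h M => [|h] M /= H; last by apply: M; rewrite H.
case Fs: (thick false s); last by apply: M; rewrite Fs.
by case: (IH s true) => // r ?; exists (1 :: r); constructor.
Qed.

Lemma shift_pad e s s' n : shift e s s' -> shift e (s ++ nseq n 0) (s' ++ nseq n 0).
Proof.
elim=> {e s s'} /=; try by constructor.
move=> e; elim: n e => [|n IH] e /=; constructor; exact: IH.
Qed.

(** When exactly one mark is blocked, each nonzero level receives the other one, so the two states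
    swap along the run. The run that starts with mark 2 has one more 2-mark when its length is
    odd. *)
Lemma num2_swap s : num2 true false s = num2 false true s + ~~ evenrun s.
Proof.
by elim: s => [|[|h] s IH] //=; rewrite /mark1 /mark2 /= ?addn0 // IH; case: (evenrun s); lia.
Qed.

(** From the free state, each successive pair of levels of the initial run carries exactly one mark
    2, and a last unpaired level carries one only if all odd positions hold at least 2 copies. The
    other two states also give one mark 2 per pair here, and none to an unpaired level. *)
Lemma num2_thick s :
  (thick false s -> num2 true true s = num2 false false s) /\
  (~~ thick true s -> num2 false true s = num2 false false s).
Proof.
elim: {s}(size s) {-2}s (leqnn (size s)) => [|n IH] [|h [|g s]] //= Hs;
  try by split=> //; case: h => [|[|h]].
have [|H1 H2] := IH s; first by lia.
have H3 := num2_swap s.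
split.
  case: h => [|h] //=; case: g => [|[|g]] //= Fs.
  have := thick_evenrun Fs; have := H1 Fs.
  have : ~~ thick true s by apply/negP => /thick_evenrun; rewrite (thick_evenrun Fs).
  move=> /H2; rewrite /mark1 /mark2 /=; case: h => [|h] /=; lia.
case: h => [|[|h]] //=; case: g => [|g] //=.
rewrite /mark1 /mark2 /= => /H2; lia.
Qed.

Lemma evenrun_nthick s : evenrun s -> ~~ thick true s.
Proof. by move=> es; apply/negP => /thick_evenrun; rewrite es. Qed.

Lemma evenrun_num2 s : evenrun s ->
  num2 true false s = num2 false false s /\ num2 false true s = num2 false false s.
Proof.
move=> es; rewrite num2_swap es addn0.
by case: (num2_thick s) => _ /(_ (evenrun_nthick es)) ->.
Qed.

(** This gives the same p on both sides. The flag that a rule puts on the remainder lets the count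
    from the state reached there be replaced by the count from the free state. *)
Lemma shift_num2 e s s' : shift e s s' -> num2 false false s' = num2 false false s.
Proof.
elim=> {e s s'} //= [s s' H IH|h s s' H IH|h g s s' H IH|h g s s' H IH].
all: rewrite /mark1 /mark2 /=.
- have [-> _] := evenrun_num2 (thick_evenrun (shift_thick H)).
  by have [-> _] := evenrun_num2 (shift_evenrun H isT); rewrite IH.
- have [_ ->] := evenrun_num2 (shift_evenrun H isT).
  by have [/(_ (shift_thick H)) -> _] := num2_thick s'; lia.
- have [_ H2] := num2_thick s'; have := H2 (negbT (shift_thick H)).
  by case: h => [|h] /=; lia.
- have [H1 H2] := evenrun_num2 (thick_evenrun (shift_thick H)).
  have [H3 H4] := evenrun_num2 (shift_evenrun H isT).
  have [/(_ (shift_thick H)) H5 _] := num2_thick s'.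
  by case: h => [|[|h]] /=; lia.
Qed.

Lemma shift_sum e s s' : shift e s s' -> sumn s' = sumn s.
Proof. by elim=> //= *; lia. Qed.

Lemma shift_weight e s s' a :
  shift e s s' -> weight a s' = weight a s + num2 false false s.
Proof.
move=> H; elim: H a => {e s s'} //=; rewrite /mark1 /mark2 /=.
- by move=> _ s s' H IH a; rewrite IH; lia.
- by move=> s s' H IH a; rewrite IH; case: (evenrun_num2 (shift_evenrun H isT)); lia.
- by move=> h s s' H IH a; rewrite IH; case: (evenrun_num2 (shift_evenrun H isT)); lia.
- by move=> h g s s' H IH a; rewrite IH; lia.
- move=> h g s s' H IH a; rewrite IH; have := evenrun_num2 (shift_evenrun H isT).
  by case: h => [|h] /= []; lia.
Qed.


(** A first entry K would force the next one to be 0, and then the sequence would be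
    [thick true]. *)
Lemma cap_nthick K s : 2 <= K -> ~~ thick true s -> cap K K s = cap K K.-1 s.
Proof.
case: s => [|h [|g s]] //= K2; rewrite ?andbT => Ts.
  by lia.
have [hK|] := eqVneq h K; last by move=> ?; congr (_ && _); lia.
rewrite hK subnn leqnn /=; have -> : K <= K.-1 = false by lia.
by case: g Ts => //; rewrite hK K2.
Qed.

(** A first entry K would be followed by an entry at least 2, exceeding the bound K+1 on the sum. *)
Lemma cap_thick K s : 1 <= K -> thick false s -> cap K.+1 K s = cap K.+1 K.-1 s.
Proof.
case: s => [|[|h] [|g s]] //= K0 /andP[g1 _].
by rewrite !andbA; congr (_ && _); lia.
Qed.

(** The part 2t+1 takes one unit of the room [d]. A pair rule gives it back by moving a part up
    while keeping the sum of the two levels. After [shift_zero] and [shift_one] the lost unit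
    reappears as a stricter bound on the remainder, which [cap_nthick] and [cap_thick] show to be no
    restriction. *)
Lemma shift_cap K d e s s' : 2 <= K -> shift e s s' -> (~~ e < d) -> d <= K ->
  cap K d s = cap K d.-1 s'.
Proof.
move=> K2 H; elim: H d => {e s s'} //=.
- move=> e s s' H IH d _ _.
  by rewrite !subn0 IH // -cap_nthick // (shift_thick H).
- move=> s s' H IH d d1 _; rewrite subn1 IH; try lia.
  have -> : 0 < d by lia.
  have -> : 0 < d.-1 by lia.
  by case: (K) K2 => //= K' ?; rewrite -cap_thick // (shift_thick H).
- move=> h s s' H IH d d1 dK; rewrite subn1 subn0.
  have -> : 0 < d by lia.
  case: (ltnP h.+1 K) => hK; last by rewrite [h.+1 <= _]leqNgt; case: ltnP; lia.
  have -> : h < K.-1 by lia.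
  rewrite /= IH; try lia.
  by congr cap; lia.
- move=> h g s s' H IH d d1 dK.
  case: (ltnP h.+1 d) => [hd|]; last by case: ltnP; lia.
  have -> : h < d.-1 by lia.
  rewrite /=; case: (leqP g (K - h.+2)) => gK; last by case: ltnP; lia.
  have -> : g < K - h.+1 by lia.
  by rewrite IH /=; [congr cap| |]; lia.
- move=> h g s s' H IH d d1 dK.
  case: (ltnP h d) => [hd|]; last by case: leqP; lia.
  have -> : h <= d.-1 by lia.
  rewrite /=; case: (ltnP g (K - h.+1)) => gK; last by case: ltnP; lia.
  have -> : g.+1 < K - h by lia.
  by rewrite IH /=; [congr cap| |]; lia.
Qed.

(** * Marks *)

Definition close (x y : nat) : bool := if odd x then x < y + 2 else x <= y + 2.

Lemma mex_pos1 S : (mex_pos S == 1) = (1 \notin S).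
Proof. by rewrite /mex_pos /=; case: ifP. Qed.

Lemma mex_pos2 S : (mex_pos S == 2) = (1 \in S) && (2 \notin S).
Proof.
rewrite /mex_pos /=; case: (boolP (1 \in S)) => //= H.
by case: S H => //= a S H; case: ifP.
Qed.

Lemma marked_cons i x s : marked i (x :: s) =
  if mex_pos [seq q.2 | q <- zip s (gg s) & close x q.1] == i
  then x :: marked i s else marked i s.
Proof. by rewrite /marked /=; case: ifP. Qed.

Lemma mem_close_marks i x s :
  (i \in [seq q.2 | q <- zip s (gg s) & close x q.1]) = has (close x) (marked i s).
Proof.
rewrite /marked; elim: (zip _ _) => //= -[y j] z IH /=.
by case: (boolP (close x y)) => Hc; case: (eqVneq j i) => [->|ne] /=;
  rewrite ?inE ?IH ?eqxx ?Hc ?(negbTE Hc) // eq_sym (negbTE ne).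
Qed.

Lemma marked1_cons x s : marked 1 (x :: s) =
  nseq (~~ has (close x) (marked 1 s)) x ++ marked 1 s.
Proof.
by rewrite marked_cons mex_pos1 mem_close_marks; case: (has _ _).
Qed.

Lemma marked2_cons x s : marked 2 (x :: s) =
  nseq (has (close x) (marked 1 s) && ~~ has (close x) (marked 2 s)) x ++ marked 2 s.
Proof.
by rewrite marked_cons mex_pos2 !mem_close_marks; case: (has _ _); case: (has _ _).
Qed.

Lemma marked_suffix i s Y : exists2 u, marked i (s ++ Y) = u ++ marked i Y & {subset u <= s}.
Proof.
elim: s => [|x s [u E sub]]; first by exists [::].
rewrite cat_cons marked_cons E; case: ifP => _.
  by exists (x :: u) => // y; rewrite !inE => /orP[->//|/sub ->]; rewrite orbT.
by exists u => // y /sub; rewrite inE => ->; rewrite orbT.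
Qed.

Lemma marked_sub i s : {subset marked i s <= s}.
Proof. by case: (marked_suffix i s [::]) => u; rewrite cats0 cats0 => ->. Qed.

Lemma count_marked (P : pred nat) s :
  count P (marked 1 s) + count P (marked 2 s) <= count P s.
Proof.
elim: s => // x s IH; rewrite marked1_cons marked2_cons !count_cat !count_nseq /=.
by case: (has _ (marked 1 s)); case: (has _ _); case: (P x); rewrite /= ?mul0n ?muln0; lia.
Qed.

Lemma mex_pos_notin (T : seq nat) : mex_pos T \notin T.
Proof.
have hT : has (fun n => n.+1 \notin T) (iota 0 (size T).+1).
  apply: contraT; rewrite -all_predC => /allP allT.
  have := @uniq_leq_size _ (iota 1 (size T).+1) T (iota_uniq _ _).
  rewrite size_iota ltnn; apply=> -[|n]; rewrite mem_iota // => nT.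
  by apply: negbNE; apply: (allT n); rewrite mem_iota.
rewrite /mex_pos; have := nth_find 0 hT; rewrite nth_iota //.
by move: hT; rewrite has_find size_iota.
Qed.

Lemma marked_pairwise i s : pairwise (fun x y => ~~ close x y) (marked i s).
Proof.
elim: s => // x s IH; rewrite marked_cons; case: eqP => //= Hi; rewrite IH andbT.
by rewrite -[all _ _]/(all (predC (close x)) _) all_predC -mem_close_marks -{1}Hi mex_pos_notin.
Qed.

Lemma marked_apart i s u v :
  u \in marked i s -> v \in marked i s -> v < u -> ~~ close u v.
Proof.
have := marked_pairwise i s; elim: (marked i s) => //= x t IH /andP[/allP Hx /IH Ht].
rewrite !inE => /orP[/eqP ->|ut] /orP[/eqP ->|vt] vu; last exact: Ht.
- by rewrite ltnn in vu.
- exact: Hx.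
(* Here the smaller part stands before the larger one, hence is close to it, against
   [marked_pairwise]. *)
- by have := Hx _ ut; rewrite /close; case: ifP; lia.
Qed.

(* [h] lists the multiplicities of the parts 2a, 2a+2, 2a+4, ... *)
Fixpoint evens (a : nat) (h : seq nat) : seq nat :=
  if h is c :: h' then evens a.+1 h' ++ nseq c a.*2 else [::].

(* The 2-marked parts of [evens a h], in increasing order. *)
Fixpoint twos (a : nat) (b1 b2 : bool) (h : seq nat) : seq nat :=
  if h is c :: h' then
    nseq (mark2 b1 b2 c) a.*2 ++ twos a.+1 (mark1 b1 c) (mark2 b1 b2 c) h'
  else [::].

Definition blocked (i a : nat) (Y : seq nat) : bool := has (close a.*2) (marked i Y).

Lemma closexx x : close x x.
Proof. by rewrite /close; case: ifP; lia. Qed.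

(** Copies of one part are close to each other, so a level uses each mark at most once. *)
Lemma marked_nseq c a Y :
  marked 1 (nseq c a.*2 ++ Y) = nseq (mark1 (blocked 1 a Y) c) a.*2 ++ marked 1 Y /\
  marked 2 (nseq c a.*2 ++ Y) =
    nseq (mark2 (blocked 1 a Y) (blocked 2 a Y) c) a.*2 ++ marked 2 Y.
Proof.
elim: c => [|c [IH1 IH2]]; first by rewrite /mark1 /mark2 andbF if_same andbF.
rewrite /= marked1_cons marked2_cons IH1 IH2 !has_cat !has_nseq closexx -/(blocked 1 a Y)
  -/(blocked 2 a Y) /mark1 /mark2 !andbT /=.
by case: (blocked 1 a Y); case: (blocked 2 a Y); case: c {IH1 IH2} => [|[|c]].
Qed.

(** This is the transition of the automaton: nothing below 2a is close to 2a+2, so only the marks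
    used at 2a count. *)
Lemma blocked_nseq c a Y : all (ltn^~ a.*2) Y ->
  blocked 1 a.+1 (nseq c a.*2 ++ Y) = mark1 (blocked 1 a Y) c /\
  blocked 2 a.+1 (nseq c a.*2 ++ Y) = mark2 (blocked 1 a Y) (blocked 2 a Y) c.
Proof.
move=> /allP ltY; rewrite {1 3}/blocked; case: (marked_nseq c a Y) => -> ->.
have far i : has (close a.+1.*2) (marked i Y) = false.
  apply/hasPn => y /marked_sub /ltY /=.
  by rewrite /close odd_double /=; lia.
have cl : close a.+1.*2 a.*2 by rewrite /close odd_double doubleS addn2.
by rewrite !has_cat !far !orbF !has_nseq cl !andbT !lt0b.
Qed.

Lemma marked2_evens a h Y : all (ltn^~ a.*2) Y ->
  marked 2 (evens a h ++ Y) = rev (twos a (blocked 1 a Y) (blocked 2 a Y) h) ++ marked 2 Y.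
Proof.
elim: h a Y => //= c h IH a Y ltY.
have [E1 E2] := blocked_nseq c ltY.
rewrite -catA IH; last first.
  rewrite all_cat all_nseq; apply/andP; split; first by rewrite doubleS; lia.
  by apply: sub_all ltY => y /=; rewrite doubleS; lia.
have [_ ->] := marked_nseq c a Y.
by rewrite E1 E2 rev_cat rev_nseq -catA.
Qed.

Lemma size_twos a b1 b2 h : size (twos a b1 b2 h) = num2 b1 b2 h.
Proof. by elim: h a b1 b2 => //= c h IH a b1 b2; rewrite size_cat IH size_nseq. Qed.

(** * Starting types *)

(** The rule for the first 2-marked part merges with the general one: its missing predecessor has
    auxiliary value [None], which makes [fresh] true, and the hypothesis turns occurrence of x+2
    into a 1-marked x+2. *)
Lemma st_sigmaS pi b (x := nth 0 (marked 2 pi) b) (one := fun y => has_marked 1 y pi)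
    (fresh := (st_sigma pi b).2 != Some (x + 2)) :
  (b = 0 -> (x + 2 \in pi) = one (x + 2)) ->
  st_sigma pi b.+1 =
  if one (x - 1) && ~~ (one (x + 2) && fresh) then (s_0, Some (x - 1))
  else if one (x - 2) && ~~ (one (x + 2) && fresh) then (s_1, Some (x - 2))
  else if one (x + 2) && fresh then (s_2, Some (x + 2))
  else if one x then (s_3, Some x) else (s_none, None).
Proof.
move=> H0; rewrite {1}/st_sigma -/st_sigma -/x -/(one _) -/(one _) -/(one _).
rewrite /fresh; case: eqP => [b0|_].
  by rewrite b0 /= andbT (H0 b0).
by case: (one (x + 2)); case: eqP.
Qed.

Lemma st_sigma_ge pi b z : (st_sigma pi b.+1).2 = Some z -> nth 0 (marked 2 pi) b <= z + 2.
Proof.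
rewrite /st_sigma -/st_sigma.
by repeat case: ifP => _; move=> // [<-]; lia.
Qed.

Lemma start_typeE pi b : b < Nm 2 pi ->
  (forall x, x \in pi -> odd x -> x < nth 0 (marked 2 pi) b) ->
  start_type pi b.+1 = (st_sigma pi b.+1).1.
Proof.
move=> bN oddlt; rewrite /start_type /= (_ : b < lstart pi) // /lstart.
have b1 : b.+1 < (Nm 2 pi).+1 by [].
apply: leq_trans (leq_bigmax_cond (Ordinal b1) _) => //=.
by apply/allP => x /oddlt H; apply/implyP.
Qed.

Lemma mem_evens a h y : y \in evens a h -> ~~ odd y && (a.*2 <= y).
Proof.
elim: h a => //= c h IH a; rewrite mem_cat mem_nseq => /orP[/IH|/andP[_ /eqP ->]].
  by case/andP => -> /=; rewrite doubleS; lia.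
by rewrite odd_double leqnn.
Qed.

Lemma mem_twos a b1 b2 h y : y \in twos a b1 b2 h -> a.*2 <= y.
Proof.
elim: h a b1 b2 => //= c h IH a b1 b2; rewrite mem_cat mem_nseq.
by case/orP => [/andP[_ /eqP ->]//|/IH]; rewrite doubleS; lia.
Qed.

Lemma marked_evens_low i a h Y y : y < a.*2 ->
  (y \in marked i (evens a h ++ Y)) = (y \in marked i Y).
Proof.
move=> ya; have [u -> sub] := marked_suffix i (evens a h) Y.
rewrite mem_cat; case: (boolP (y \in u)) => //= /sub /mem_evens; lia.
Qed.

Lemma nth_marked2_evens a h Y x L : all (ltn^~ a.*2) Y -> marked 2 Y = x :: L ->
  nth 0 (marked 2 (evens a h ++ Y)) (num2 (blocked 1 a Y) (blocked 2 a Y) h) = x.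
Proof.
move=> ltY EY; rewrite marked2_evens // EY nth_cat size_rev size_twos ltnn subnn //.
Qed.

(* Along a run of nonzero levels above a 2-marked part the types s_2 and s_0/s_1
   are decided from the top, hence by the parity of its length. *)
Lemma st_sigma_run a h Y L :
  all (leq^~ a.*2) Y -> marked 2 Y = a.*2 :: L -> a.*2 \notin marked 1 Y ->
  (a.*2 - 1 \in marked 1 Y) || (a.*2 - 2 \in marked 1 Y) ->
  st_sigma (evens a.+1 h ++ Y) (num2 false true h).+1 =
  if evenrun h then
    if a.*2 - 1 \in marked 1 Y then (s_0, Some (a.*2 - 1)) else (s_1, Some (a.*2 - 2))
  else (s_2, Some (a.*2 + 2)).
Proof.
have [n] := ubnP (size h); elim: n => // n IH in h a Y L * => Hs leY EY n1 o1.
have ltY : all (ltn^~ a.+1.*2) Y by apply: sub_all leY => y /=; rewrite doubleS; lia.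
have bl1 : blocked 1 a.+1 Y = false.
  apply/hasPn => y yY; have := allP leY _ (marked_sub yY); rewrite /close odd_double /= doubleS.
  have : y != a.*2 by apply: contraNneq n1 => <-.
  by lia.
have bl2 : blocked 2 a.+1 Y by rewrite /blocked EY /= /close odd_double doubleS addn2 leqnn.
set pi := evens _ _ ++ _.
have nx : nth 0 (marked 2 pi) (num2 false true h) = a.*2.
  by have := nth_marked2_evens h ltY EY; rewrite bl1 bl2.
have low y : y <= a.*2 -> has_marked 1 y pi = (y \in marked 1 Y).
  by move=> ya; apply: marked_evens_low; rewrite doubleS; lia.
have a2 : a.*2 + 2 = a.+1.*2 by rewrite doubleS addn2.
have notY i : a.+1.*2 \in marked i Y = false.
  by apply/negP => /marked_sub /(allP leY); rewrite doubleS /=; lia.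
have notY' : a.+1.*2 \in Y = false.
  by apply/negP => /(allP leY); rewrite doubleS /=; lia.
have up : has_marked 1 a.+1.*2 pi = (head 0 h != 0).
  rewrite /has_marked /pi; case: (h) => [|c h'] /=; first exact: notY.
  rewrite -catA marked_evens_low; last by rewrite !doubleS; lia.
  by have [-> _] := marked_nseq c a.+1 Y; rewrite mem_cat notY orbF mem_nseq eqxx andbT bl1 lt0b.
have up' : (a.+1.*2 \in pi) = (head 0 h != 0).
  rewrite /pi mem_cat notY' orbF; case: (h) => //= c h'; rewrite mem_cat mem_nseq eqxx andbT lt0n.
  case: (boolP (_ \in evens _ _)) => // /mem_evens/andP[_].
  by rewrite !doubleS; clear; lia.
rewrite st_sigmaS nx a2 ?up ?up' // !low ?leq_subr //.
set f := (st_sigma _ _).2 != _.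
have ef : (head 0 h != 0) && f = ~~ evenrun h.
  rewrite /f; case def_h: h Hs => [|[|c] [|[|g] h']] // Hs.
  (* A run of length one: the next 2-marked part is at least 2a+6, so its auxiliary value is at
     least 2a+4 and cannot be 2a+2. *)
  - rewrite [num2 _ _ _]/= [RHS]/= [_ && _]/= /mark1 /mark2 /= add0n; case m: (num2 _ _ h') => [|m'] //.
    apply/eqP => /st_sigma_ge; rewrite /pi marked2_evens // bl1 bl2 def_h /= /mark1 /mark2 /= nth_cat.
    rewrite size_rev size_twos m ltnSn.
    have /mem_twos : nth 0 (rev (twos a.+3 false false h')) m' \in twos a.+3 false false h'.
      by rewrite -mem_rev mem_nth // size_rev size_twos m.
    by rewrite !doubleS; clear; lia.
  (* The next 2-marked part is 2a+4, with 2a+2 carrying mark 1 between. By induction its auxiliary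
     value is 2a+2 (type s_1) or 2a+6 (type s_2), according to the parity of the rest of the run. *)
  - have -> : num2 false true [:: c.+1, g.+1 & h'] = (num2 false true h').+1 by [].
    have -> : ~~ evenrun [:: c.+1, g.+1 & h'] = ~~ evenrun h' by rewrite /= negbK.
    rewrite (_ : (head 0 _ != 0) = true) // andTb.
    pose Y' := nseq g.+1 a.+2.*2 ++ nseq c.+1 a.+1.*2 ++ Y.
    have [B1 B2] := blocked_nseq c.+1 ltY.
    have [E1 E2] := marked_nseq c.+1 a.+1 Y.
    have [E3 E4] := marked_nseq g.+1 a.+2 (nseq c.+1 a.+1.*2 ++ Y).
    rewrite B1 B2 bl1 bl2 in E3 E4; rewrite E1 bl1 in E3; rewrite E2 bl1 bl2 EY in E4.
    rewrite -/Y' in E3 E4.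
    have -> : pi = evens a.+3 h' ++ Y' by rewrite /pi def_h /= -!catA.
    have le1 y : a.+1.*2 < y -> y \in marked 1 Y = false.
      by move=> ya; apply/negP => /marked_sub /(allP leY) /=; move: ya; rewrite !doubleS; clear; lia.
    have mE y : a.+1.*2 < y -> y \in marked 1 Y' = false.
      by move=> ya; rewrite E3 /= inE le1 // orbF; apply/eqP => E; rewrite E ltnn in ya.
    rewrite (IH _ _ _ _ _ _ E4); rewrite ?[a.+2.*2 \in _]mE ?[a.+2.*2 - 1 \in _]mE ?subn2 //.
    + rewrite doubleS /=; case: (evenrun h') => /=; first by rewrite eqxx.
      by apply/eqP => -[]; clear; lia.
    + exact: ltn_trans (ltnSn _) Hs.
    + rewrite !all_cat !all_nseq !doubleS; apply/and3P; split.
      * by rewrite leqnn orbT.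
      * by rewrite (leq_trans (leqnSn _)) ?orbT.
      * by apply: sub_all leY => y /=; clear; lia.
    + by rewrite E3 doubleS inE eqxx orbT.
rewrite ef; case: (evenrun h) => /=; last by rewrite !andbF.
by rewrite !andbT; case: ifP o1 => //= _ ->.
Qed.

(** The 1-marked copy of 2a keeps mark 1 away from 2a-2, 2a-1 and 2a+2, so only the last case can
    apply. For a = 0 truncated subtraction would identify these values with 2a. *)
Lemma st_sigma_pair a h Y L : 0 < a ->
  all (leq^~ a.*2) Y -> marked 2 Y = a.*2 :: L -> a.*2 \in marked 1 Y ->
  (st_sigma (evens a.+1 h ++ Y) (num2 true true h).+1).1 = s_3.
Proof.
move=> a0 leY EY n1.
have ltY : all (ltn^~ a.+1.*2) Y by apply: sub_all leY => y /=; rewrite doubleS; lia.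
have cl : close a.+1.*2 a.*2 by rewrite /close odd_double doubleS addn2.
have bl1 : blocked 1 a.+1 Y by apply/hasP; exists a.*2.
have bl2 : blocked 2 a.+1 Y by apply/hasP; exists a.*2; rewrite // EY mem_head.
have := nth_marked2_evens h ltY EY; rewrite bl1 bl2; set pi := evens _ _ ++ _ => nx.
have n1pi : has_marked 1 a.*2 pi by rewrite /has_marked marked_evens_low // doubleS.
have apart y : y != a.*2 -> y <= a.*2 + 2 -> a.*2 <= y + 2 -> has_marked 1 y pi = false.
  move=> ya y1 y2; apply/negP => y1pi.
  have [lt|lt] : y < a.*2 \/ a.*2 < y by lia.
    by have := marked_apart n1pi y1pi lt; rewrite /close odd_double; lia.
  by have := marked_apart y1pi n1pi lt; rewrite /close; case: ifP; lia.
have out y : y \in [:: a.*2 - 1; a.*2 - 2; a.*2 + 2] -> has_marked 1 y pi = false.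
  by rewrite !inE => yE; apply: apart; move: a0 yE; clear; lia.
rewrite /st_sigma -/st_sigma nx n1pi (out (a.*2 - 1)) ?(out (a.*2 - 2)) ?(out (a.*2 + 2))
  ?inE ?eqxx ?orbT //=.
by case: ifP.
Qed.

Lemma marked2_close y s : y \in marked 2 s -> has (close y) (marked 1 s).
Proof.
elim: s => // x s IH; rewrite marked1_cons marked2_cons has_cat mem_cat mem_nseq.
case/orP => [|/IH ->]; last by rewrite orbT.
by case/andP; rewrite lt0b => /andP[H _] /eqP ->; rewrite H orbT.
Qed.

Lemma blocked_top i t Y : all (leq^~ t.*2) Y -> blocked i t.+1 Y = (t.*2 \in marked i Y).
Proof.
move=> leY; apply/hasP/idP => [[y yY]|]; last by exists t.*2; rewrite // /close odd_double doubleS addn2.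
rewrite /close odd_double doubleS => ay; have /= ya := allP leY _ (marked_sub yY).
by have -> : t.*2 = y by move: ay ya; clear; lia.
Qed.

Definition type_at (a : nat) (h Y : seq nat) : stype :=
  if a.*2 \in marked 1 Y then s_3
  else if evenrun h then if a.*2 - 1 \in marked 1 Y then s_0 else s_1
  else s_2.

(** All odd parts lie below 2a, so the case rules do apply to it. Its index is one more than the
    number of 2-marked parts above it. *)
Lemma has_type_evens a h Y L s : 0 < a -> all (leq^~ a.*2) Y -> marked 2 Y = a.*2 :: L ->
  has_type (evens a.+1 h ++ Y) (num2 (a.*2 \in marked 1 Y) true h).+1 s <->
  type_at a h Y = s.
Proof.
move=> a0 leY EY; set pi := _ ++ _; set n := num2 _ _ _.
have ltY : all (ltn^~ a.+1.*2) Y by apply: sub_all leY => y /=; rewrite doubleS; lia.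
have bl2 : blocked 2 a.+1 Y by rewrite /blocked EY /= /close odd_double doubleS addn2 leqnn.
have bl1 := blocked_top 1 leY.
have nx := nth_marked2_evens h ltY EY; rewrite bl1 bl2 -/pi -/n in nx.
have nN : n < Nm 2 pi.
  by rewrite /Nm /pi marked2_evens // bl1 bl2 EY size_cat size_rev size_twos /= -/n addnS ltnS leq_addr.
have -> : type_at a h Y = start_type pi n.+1.
  rewrite start_typeE //; last first.
    move=> x; rewrite nx mem_cat => /orP[/mem_evens/andP[/negbTE->]//|/(allP leY) /= xa ox].
    by rewrite ltn_neqAle xa andbT; apply: contraTneq ox => ->; rewrite odd_double.
  rewrite /type_at /n; case: ifP => n1; first by rewrite (st_sigma_pair _ _ _ EY).
  rewrite (st_sigma_run _ _ EY) ?n1 //; first by case: (evenrun h) => //; case: ifP.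
  have /marked2_close/hasP[y yY] : a.*2 \in marked 2 Y by rewrite EY mem_head.
  have /= ya := allP leY _ (marked_sub yY).
  have : y != a.*2 by apply: contraFneq n1 => <-.
  rewrite /close odd_double => y2 y1.
  have [<-|<-] : y = a.*2 - 1 \/ y = a.*2 - 2 by move: y1 y2 ya; clear; lia.
    by rewrite yY.
  by rewrite yY orbT.
by rewrite /has_type; split=> [[]|->] //; split.
Qed.

(** Mark 2 at one level blocks it at the next; a blocked start costs one more level. *)
Lemma nth_twos_ge a b1 b2 h j : j < num2 b1 b2 h ->
  (a + b2 + j.*2).*2 <= nth 0 (twos a b1 b2 h) j.
Proof.
elim: h a b1 b2 j => //= c h IH a b1 b2 j; rewrite nth_cat size_nseq nth_nseq.
case m2: (mark2 b1 b2 c) => /=.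
  have b20 : b2 = false by move: m2; rewrite /mark2; case: b2.
  rewrite b20 in m2 *; case: j => [|j]; first by rewrite /= !addn0.
  by rewrite subn1 /= => jn; have := IH a.+1 (mark1 b1 c) true j jn; clear; lia.
by rewrite subn0 => jn; have := IH a.+1 (mark1 b1 c) false j jn; clear; lia.
Qed.

(* Consecutive 2-marked parts differ by at least 4, so the chains in conditions
   (4) and (6) of C_= are initial segments of [twos] with all gaps equal to 4. *)
Lemma twos_free_not_one a h j : j < num2 false false h ->
  nth 0 (twos a false false h) j = (a + j.*2).*2 -> nth 0 h j.*2 != 1.
Proof.
have [n] := ubnP (size h); elim: n => // n IH in h a j *.
case: h => [|[|[|c]] h] //= hn.
- by move=> jn E; have := nth_twos_ge a.+1 jn; rewrite E; lia.
- by move=> jn E; have := nth_twos_ge a.+1 jn; rewrite E; lia.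
case: j => [|j] //; case: h hn => [|g h] //= hn jn E.
apply: (IH h a.+2 j) => //; first exact: ltn_trans (ltnSn _) hn.
by apply: etrans E _; clear; lia.
Qed.

(** Inside the run the chain visits odd positions, which hold at least 2 copies. Past the first
    empty level the marking is in the free state, where mark 2 also needs two copies. *)
Lemma twos_thick_not_one a h j : thick true h -> j < num2 true false h ->
  nth 0 (twos a true false h) j = (a + j.*2).*2 -> nth 0 h j.*2 != 1.
Proof.
have [n] := ubnP (size h); elim: n => // n IH in h a j *.
case: h => [|[|[|c]] [|[|g] h]] //= hn; case: j => [|j] // th jn E.
- apply: (@twos_free_not_one a.+2 h j) => //.
  by apply: etrans E _; clear; lia.
- apply: (IH h a.+2 j) => //; first exact: ltn_trans (ltnSn _) hn.
  by apply: etrans E _; clear; lia.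
Qed.

(** Marks 2 and 1 alternate along the run, so the 2-marked parts occupy its odd positions, and one
    of these must break thickness. *)
Lemma twos_one a h : ~~ evenrun h -> ~~ thick true h ->
  exists j, [/\ j < num2 true false h,
    nth 0 (twos a true false h) j = (a + j.*2).*2 & nth 0 h j.*2 = 1].
Proof.
have [n] := ubnP (size h); elim: n => // n IH in h a *.
case: h => [|[|[|c]] h] //= hn; first by exists 0; rewrite /= addn0.
case: h hn => [|[|g] h] //= hn; rewrite negbK => oh th.
case: (IH h a.+2) => // [|j [jn E h1]]; first by lia.
by exists j.+1; split=> //=; rewrite E; lia.
Qed.

(** From the free state a level with mark 2 has two copies and leaves the next nonzero level without
    mark 1 or 2. The chain of gaps 4 thus traces an odd run up to the first empty neighbour. *)
Lemma twos_gap a h :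
  (exists j, [/\ j < num2 false false h,
    nth 0 (twos a false false h) j = (a + j.*2).*2 & nth 0 h j.*2.+1 = 0]) <-> thick true h.
Proof.
have [n] := ubnP (size h); elim: n => // n IH in h a *.
case: h => [|[|[|c]] h] //= hn; try by split=> // -[j []].
- split=> // -[j [jn E _]]; have := nth_twos_ge a.+1 jn; rewrite E; lia.
- split=> // -[j [jn E _]]; have := nth_twos_ge a.+1 jn; rewrite E; lia.
case: h hn => [|[|g] h] /= hn; try by split=> // _; exists 0; rewrite double0 !addn0.
have {}IH := IH h a.+2 (ltn_trans (ltnSn _) hn); split=> [[[|j] [jn E h0]] //|].
  by apply/IH; exists j; split=> //; apply: etrans E _; clear; lia.
case/IH=> j [jn E h0]; exists j.+1; split=> //.
by apply: etrans E _; clear; lia.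
Qed.

(** * Decomposition at the level 2t *)

Lemma sumn_evens a h : sumn (evens a h) = (weight a h).*2.
Proof.
elim: h a => //= c h IH a; rewrite sumn_cat sumn_nseq IH; lia.
Qed.

Lemma size_evens a h : size (evens a h) = sumn h.
Proof. by elim: h a => //= c h IH a; rewrite size_cat size_nseq IH addnC. Qed.

Lemma count_evens a h b :
  count_mem b.*2 (evens a h) = if b < a then 0 else nth 0 h (b - a).
Proof.
elim: h a => [|c h IH] a /=; first by rewrite nth_nil if_same.
rewrite count_cat count_nseq IH /= (inj_eq double_inj).
by case: (ltngtP a b) => ab; rewrite ?mul0n ?mul1n ?addn0 //=;
  [rewrite ltnS leqNgt ab subnS; case: (b - a) (subn_gt0 a b) => //; rewrite ab
  |rewrite ltnS ltnW //|rewrite ab ltnSn subnn].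
Qed.

Lemma count_evens_odd a h x : odd x -> count_mem x (evens a h) = 0.
Proof. by move=> ox; apply/count_memPn; apply: contraL ox => /mem_evens/andP[]. Qed.

Lemma geq_trans : transitive geq.
Proof. by move=> y x z /= yx zy; apply: leq_trans zy yx. Qed.

Lemma sorted_nseq_cat c x Y : sorted geq Y -> all (leq^~ x) Y -> sorted geq (nseq c x ++ Y).
Proof.
move=> sY leY; elim: c => //= c IH; rewrite path_sortedE; last exact: geq_trans.
rewrite IH andbT all_cat all_nseq /= leqnn orbT.
by apply: sub_all leY => y.
Qed.

Lemma sorted_evens a h Y :
  sorted geq Y -> all (leq^~ a.*2) Y -> sorted geq (evens a h ++ Y).
Proof.
elim: h a Y => //= c h IH a Y sY leY; rewrite -catA; apply: IH.
  exact: sorted_nseq_cat.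
rewrite all_cat all_nseq doubleS; apply/andP; split; first by lia.
by apply: sub_all leY => y /=; lia.
Qed.

Lemma sorted_top x s : sorted geq s -> all (leq^~ x) s ->
  s = nseq (count_mem x s) x ++ [seq y <- s | y < x].
Proof.
elim: s => //= y s IH ys /andP[yx sx].
have := IH (path_sorted ys) sx; case: eqVneq => [->|nyx]; first by rewrite ltnn /= => <-.
have lyx : y < x by rewrite ltn_neqAle nyx.
rewrite lyx add0n => {1}->; suff /count_memPn -> : x \notin s by [].
by move: ys; rewrite path_sortedE; [case/andP => /allP H _; apply/negP => /H /=; lia|exact: geq_trans].
Qed.

Lemma evens_decomp a s : sorted geq s -> (forall x, x \in s -> a.*2 <= x -> ~~ odd x) ->
  exists h, s = evens a h ++ [seq x <- s | x < a.*2].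
Proof.
(* Every part is at most [sumn s], so enough levels exist to pass the largest part. *)
move=> ss ev; have [n] : exists n, all (ltn^~ (a + n).*2) s.
  exists (sumn s).+1; apply/allP => x xs /=.
  have : x <= sumn s by rewrite (perm_sumn (perm_to_rem xs)) /= leq_addr.
  by lia.
elim: n a ev => [|n IH] a ev.
  by rewrite addn0 => /all_filterP ->; exists [::].
rewrite addnS -addSn => /IH [|h E].
  by move=> x xs ax; apply: ev => //; move: ax; rewrite doubleS; lia.
exists (count_mem a.*2 s :: h); rewrite /= -catA {1}E; congr (_ ++ _).
have sf : sorted geq [seq x <- s | x < a.+1.*2] by apply: sorted_filter => //; exact: geq_trans.
have le : all (leq^~ a.*2) [seq x <- s | x < a.+1.*2].
  apply/allP => x; rewrite mem_filter doubleS => /andP[x1 xs] /=.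
  by rewrite leqNgt; apply/negP => ax; have := ev _ xs; rewrite (_ : x = a.*2.+1) /=; rewrite ?odd_double; lia.
rewrite {1}(sorted_top sf le) -filter_predI; congr (nseq _ _ ++ _).
  rewrite count_filter; apply: eq_count => x /=; rewrite doubleS; case: eqP => //= ->; lia.
by apply: eq_filter => x /=; rewrite doubleS; lia.
Qed.

Lemma leq_nth_sorted x s j : 0 < x -> sorted geq s -> (x <= nth 0 s j) = (j < count (leq x) s).
Proof.
move=> x0; elim: s j => [|y s IH] j /=; first by rewrite nth_nil; case: x x0.
rewrite path_sortedE; last exact: geq_trans.
case/andP => /allP ys ss; case: (leqP x y) => xy; first by case: j => [|j]; rewrite /= ?xy ?IH.
have -> : count (leq x) s = 0.
  by apply/eqP; rewrite -leqn0 leqNgt -has_count; apply/hasPn => z /ys /=; lia.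
case: j => [|j] /=; first by lia.
by apply/negbTE; rewrite -ltnNge; case: (ltnP j (size s)) => [/(mem_nth 0)/ys /=|/(nth_default 0) ->]; lia.
Qed.

(** * Membership in C(k,r) as bounds on multiplicities *)

Definition window (k r : nat) (s : seq nat) (a : nat) : bool :=
  (if a == 0 then k - r else count_mem a.*2 s) + count_mem a.*2.+1 s + count_mem a.*2.+2 s
    <= k - 1.

Lemma count_leqS x s : count (leq x) s = count_mem x s + count (leq x.+1) s.
Proof. by elim: s => //= y s ->; case: (ltngtP x y) => H /=; lia. Qed.

(** A violation of the difference condition puts k consecutive parts into one window 2a, 2a+1, 2a+2:
    for largest part x take a = (x-1)/2 if x is odd and a = x/2-1 if x is even. For a = 0 the bound
    r-1 already forbids this, since r <= k. *)
Lemma inC_window k r s : 3 <= r -> r <= k ->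
  inC k r s <-> [/\ is_partition s, forall x, odd x -> count_mem x s <= 1 &
                    forall a, window k r s a].
Proof.
move=> r3 rk; have small : is_partition s -> count (fun x => x <= 2) s = count_mem 1 s + count_mem 2 s.
  case/andP => _; elim: s => //= y s IH /andP[y0 /IH ->].
  by case: y y0 => [|[|[|y]]] //= _; lia.
split=> [[ps [od [win sm]]]|[ps od win]].
  have [ss pos] := andP ps.
  split=> // -[|a]; rewrite /window.
    by move: sm; rewrite small // eqxx double0; lia.
  case: (a.+1 =P 0) => // _; rewrite leqNgt; apply/negP => big.
  (* Exactly [i] parts exceed the window, so an overfull window contains the k parts at positions i
     to i+k-1. *)
  set i := count (leq a.+1.*2.+3) s.
  have ci : count (leq a.+1.*2) s = count_mem a.+1.*2 s + count_mem a.+1.*2.+1 s + count_mem a.+1.*2.+2 s + i.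
    by rewrite 3!count_leqS -/i !addnA.
  have lo : a.+1.*2 <= nth 0 s (i + k - 1) by rewrite leq_nth_sorted // ci; move: big r3 rk; clear; lia.
  have hi : ~~ (a.+1.*2.+3 <= nth 0 s i) by rewrite leq_nth_sorted // ltnn.
  have szi : i + k - 1 < size s.
    by rewrite ltnNge; apply/negP => /(nth_default 0) E; rewrite E in lo.
  have := win i szi; move: lo hi; clear; case: ifP; lia.
have [ss pos] := andP ps.
split=> //; split=> //; split; last first.
  by have := win 0; rewrite small // /window eqxx double0; lia.
move=> i isz; set x := nth 0 s i; set y := nth 0 s _.
have y0 : 0 < y by apply: (allP pos); rewrite mem_nth.
have key a : x < a.*2.+3 -> a.*2 <= y -> False.
  move=> xa ay; have := win a; rewrite /window.
  have c1 : count (leq a.*2.+3) s <= i by rewrite leqNgt -leq_nth_sorted // -ltnNge.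
  have c0 b : 0 < b -> b <= y -> i + k - 1 < count (leq b) s by move=> b0; rewrite leq_nth_sorted.
  case: a xa ay c1 => [|a] xa ay c1.
    rewrite eqxx double0; have := c0 1 isT y0; rewrite 2!count_leqS.
    by move: c1 r3 rk; rewrite double0; clear; lia.
  case: (a.+1 =P 0) => // _; have := c0 a.+1.*2 isT ay; rewrite 3!count_leqS.
  by move: c1 r3 rk; clear; lia.
have xy : y <= x.
  have := leq_nth_sorted i y0 ss; rewrite -/x => ->.
  by apply: leq_ltn_trans (_ : i + k - 1 < _); rewrite -?leq_nth_sorted //; move: r3 rk; clear; lia.
have := odd_double_half x; case: ifP => ox /= xE; rewrite leqNgt; apply/negP => lt.
  by apply: (key x./2); move: xE lt; clear; lia.
by apply: (key x./2.-1); move: xE lt xy y0; clear; lia.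
Qed.

Lemma capP K d h : d <= K ->
  cap K d h <-> head 0 h <= d /\ forall j, nth 0 h j + nth 0 h j.+1 <= K.
Proof.
elim: h d => [|c h IH] d dK /=; first by split=> // _; split=> // j; rewrite nth_nil.
split=> [/andP[cd /(IH _ (leq_subr _ _))[hd sums]]|[cd sums]].
  by split=> // -[|j] //=; rewrite nth0; lia.
rewrite cd; apply/(IH _ (leq_subr _ _)); split=> [|j]; last exact: (sums j.+1).
by have /= := sums 0; rewrite nth0; lia.
Qed.

Lemma window_evens k r t h X (c := if t == 0 then k - r else count_mem t.*2 X)
    (e := c + count_mem t.*2.+1 X) :
  all (leq^~ t.*2.+1) X ->
  (forall a, window k r (evens t.+1 h ++ X) a) <->
  [/\ forall a, a < t -> window k r X a, e <= k - 1 & cap (k - 1) (k - 1 - e) h].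
Proof.
move=> leX; have cX x : t.*2.+1 < x -> count_mem x X = 0.
  by move=> tx; apply/count_memPn; apply/negP => /(allP leX) /=; lia.
have wE a : window k r (evens t.+1 h ++ X) a =
    if a < t then window k r X a
    else if a == t then e + nth 0 h 0 <= k - 1
    else nth 0 h (a - t.+1) + nth 0 h (a - t) <= k - 1.
  rewrite /window -!doubleS !count_cat !(count_evens_odd _ _ (_ : odd _.*2.+1)) ?[odd _.+1]/= ?odd_double //.
  rewrite !count_evens !ltnS; case: (ltngtP a t) => [at_|ta|->]; rewrite ?ltnS.
  - by rewrite !add0n.
  - rewrite !cX ?doubleS; last 1 first; try by move: ta; clear; lia.
    by rewrite !addn0 subSS; case: eqP ta => // ->.
  - by rewrite subnn !add0n (cX t.+1.*2) ?doubleS // addn0.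
split=> [W|[W eK /(capP _ (leq_subr _ _))[hd sums]] a]; last first.
  rewrite wE; case: (ltngtP a t) => [/W//|ta|_]; last by rewrite nth0; lia.
  by have := sums (a - t.+1); rewrite -subSn.
have We : e + nth 0 h 0 <= k - 1 by have := W t; rewrite wE ltnn eqxx.
split.
- by move=> a at_; have := W a; rewrite wE at_.
- exact: leq_trans (leq_addr _ _) We.
apply/(capP _ (leq_subr _ _)); split=> [|j]; first by rewrite -nth0; lia.
have := W (j + t.+1); rewrite wE addnK -addSnnS addnK.
by case: (ltngtP (j.+1 + t) t) => //; lia.
Qed.

Definition lower_part (k r t : nat) (low : seq nat) : Prop :=
  [/\ sorted geq low, all (fun x => 0 < x) low, all (leq^~ t.*2) low,
      forall x, odd x -> count_mem x low <= 1 &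
      forall a, a < t -> window k r low a].

(* The bound r - 1 on the number of parts at most 2 is the window condition at 0
   with k - r phantom parts equal to 0. *)
Definition load (k r t : nat) (low : seq nat) : nat :=
  if t == 0 then k - r else count_mem t.*2 low.

Lemma count_over x t low : all (leq^~ t.*2) low -> t.*2 < x -> count_mem x low = 0.
Proof. by move=> le tx; apply/count_memPn; apply/negP => /(allP le) /=; lia. Qed.

Lemma inC_even_top k r t h low : 3 <= r -> r <= k -> all (leq^~ t.*2) low ->
  inC k r (evens t.+1 h ++ low) <->
  [/\ lower_part k r t low, load k r t low <= k - 1 & cap (k - 1) (k - 1 - load k r t low) h].
Proof.
move=> r3 rk le; have leS : all (leq^~ t.*2.+1) low by apply: sub_all le => x /=; lia.
rewrite inC_window //; split=> [[/andP[ss pos] od /(window_evens _ _ _ leS)]|].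
  rewrite (count_over le (ltnSn _)) addn0 -/(load _ _ _ _) => -[W ? ?]; split=> //.
  move: pos; rewrite all_cat => /andP[_ pos].
  split=> // [|x ox]; first by case: (cat_sorted2 ss).
  by have := od x ox; rewrite count_cat count_evens_odd.
case=> -[ss pos _ od W] lK cp; split.
- rewrite /is_partition sorted_evens //= ?all_cat ?pos ?andbT; last first.
    by apply: sub_all le => x /=; rewrite doubleS; lia.
  by apply/allP => x /mem_evens; rewrite doubleS; lia.
- by move=> x ox; rewrite count_cat count_evens_odd // od.
- apply/window_evens => //; rewrite (count_over le (ltnSn _)) addn0 -/(load _ _ _ _); split=> //.
Qed.

Lemma inC_odd_top k r t h low : 3 <= r -> r <= k -> all (leq^~ t.*2) low ->
  inC k r (evens t.+1 h ++ t.*2.+1 :: low) <->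
  [/\ lower_part k r t low, load k r t low < k - 1 & cap (k - 1) (k - 1 - load k r t low).-1 h].
Proof.
move=> r3 rk le; have leS : all (leq^~ t.*2.+1) (t.*2.+1 :: low).
  by rewrite /= leqnn; apply: sub_all le => x /=; lia.
have cT x : x <= t.*2 -> count_mem x (t.*2.+1 :: low) = count_mem x low.
  by move=> xt /=; case: eqP; lia.
have WT a : a < t -> window k r (t.*2.+1 :: low) a = window k r low a.
  by move=> at_; rewrite /window !cT //; lia.
have E : (if t == 0 then k - r else count_mem t.*2 (t.*2.+1 :: low)) +
    count_mem t.*2.+1 (t.*2.+1 :: low) = (load k r t low).+1.
  by rewrite cT // -/(load k r t low) /= eqxx (count_over le) // addn1.
rewrite inC_window //; split=> [[/andP[ss pos] od /(window_evens _ _ _ leS)]|].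
  rewrite E (subnS (k - 1)) => -[W ? ?]; split=> //.
  move: pos; rewrite all_cat => /and3P[_ _ pos].
  split=> // [|x ox|a at_]; last by rewrite -WT ?W.
    by case: (cat_sorted2 ss) => _ /path_sorted.
  by have := od x ox; rewrite count_cat count_evens_odd //=; apply: leq_trans; apply: leq_addl.
case=> -[ss pos _ od W] lK cp; split.
- rewrite /is_partition sorted_evens ?all_cat /= ?pos ?andbT.
  + by apply/allP => x /mem_evens; rewrite doubleS; lia.
  + rewrite path_sortedE ?ss ?andbT; last exact: geq_trans.
    by apply: sub_all le => x /=; lia.
  + by rewrite doubleS; apply/andP; split; [lia|apply: sub_all le => x /=; lia].
- move=> x ox; rewrite count_cat count_evens_odd //= add0n.
  by case: eqP => [<-|_]; [rewrite (count_over le)|rewrite od].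
- apply/window_evens => //; rewrite E (subnS (k - 1)); split=> // a at_; by rewrite WT ?W.
Qed.

(* A mark 1 or 2 missing on 2t is carried by a part 2t-1 or 2t-2, which takes up
   room in the window ending at 2t. *)
Lemma load_bound k r t low : 3 <= r -> r <= k -> lower_part k r t low ->
  let b1 := t.*2 \in marked 1 low in let b2 := t.*2 \in marked 2 low in
  ~~ (b1 && b2) -> load k r t low + ~~ (b1 || b2) < k - 1.
Proof.
move=> r3 rk [ss pos le _ W] b1 b2; rewrite /load.
have [t0|] := eqVneq t 0.
  have l0 : low = [::].
    move: le pos; rewrite t0; case: (low) => //= x s /andP[x0 _] /andP[x1 _]; lia.
  by rewrite /b1 /b2 l0 /=; lia.
case: t => // t in le W b1 b2 * => _.
set c := count_mem _ _; set low' := [seq y <- low | y < t.+1.*2].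
have lowE := sorted_top ss le; rewrite -/c -/low' in lowE.
have notin i : t.+1.*2 \in marked i low' = false.
  by apply/negP => /marked_sub; rewrite mem_filter ltnn.
have [m1 m2] := marked_nseq c t.+1 low'; rewrite -lowE in m1 m2.
have b1E : b1 = mark1 (blocked 1 t.+1 low') c.
  by rewrite /b1 m1 mem_cat notin orbF mem_nseq eqxx andbT lt0b.
have b2E : b2 = mark2 (blocked 1 t.+1 low') (blocked 2 t.+1 low') c.
  by rewrite /b2 m2 mem_cat notin orbF mem_nseq eqxx andbT lt0b.
have bl : blocked 1 t.+1 low' + blocked 2 t.+1 low' <= count_mem t.*2 low + count_mem t.*2.+1 low.
  have cl : count (close t.+1.*2) low' = count_mem t.*2 low + count_mem t.*2.+1 low.
    rewrite /low'; elim: (low) => //= x s IH; rewrite [in LHS]fun_if /= IH /close odd_double /= !doubleS.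
    by case: (ltngtP x t.*2) => H1; case: (ltngtP x t.*2.+1) => H2; case: ifP; lia.
  rewrite -cl; apply: leq_trans (count_marked _ _).
  by apply: leq_add; rewrite /blocked has_count; case: (count _ _).
have win : count_mem t.*2 low + count_mem t.*2.+1 low + c <= k - 1.
  have := W t (leqnn _); rewrite /window /c doubleS; case: eqP => // ->.
  have : count_mem 0 low = 0 by apply/count_memPn; apply/negP => /(allP pos).
  by rewrite double0; lia.
rewrite b1E b2E /mark1 /mark2; move: bl win.
by case: (blocked 1 _ _); case: (blocked 2 _ _) => /=; case: (c) => [|[|c']] //=; lia.
Qed.

(** * The sets C_< and C_= in terms of multiplicities *)

Lemma close_odd_top i t Y : all (leq^~ t.*2) Y ->
  has (close t.*2.+1) (marked i Y) = (t.*2 \in marked i Y).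
Proof.
have cE y : close t.*2.+1 y = (t.*2 <= y) by rewrite /close /= odd_double addn2 !ltnS.
move=> leY; apply/hasP/idP => [[y yY]|]; last by exists t.*2; rewrite // cE.
rewrite cE => ay; have /= ya := allP leY _ (marked_sub yY).
by have -> : t.*2 = y by move: ay ya; clear; lia.
Qed.

Lemma marked_odd_top t low (b1 := t.*2 \in marked 1 low) (b2 := t.*2 \in marked 2 low) :
  all (leq^~ t.*2) low ->
  marked 1 (t.*2.+1 :: low) = nseq (~~ b1) t.*2.+1 ++ marked 1 low /\
  marked 2 (t.*2.+1 :: low) = nseq (b1 && ~~ b2) t.*2.+1 ++ marked 2 low.
Proof. by move=> le; rewrite marked1_cons marked2_cons !close_odd_top. Qed.

(** If 2t has mark 1, it blocks mark 1 itself, and 2t+1 takes mark 2 unless 2t has that too.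
    Otherwise 2t+1 takes mark 1. This is the state in which the levels above 2t+1 are read. *)
Lemma blocked_odd_top t low : all (leq^~ t.*2) low ->
  blocked 1 t.+1 (t.*2.+1 :: low) /\
  blocked 2 t.+1 (t.*2.+1 :: low) = (t.*2 \in marked 1 low) || (t.*2 \in marked 2 low).
Proof.
move=> le; have [E1 E2] := marked_odd_top le.
have cl : close t.+1.*2 t.*2.+1 by rewrite /close odd_double doubleS addn2.
have h i : has (close t.+1.*2) (marked i low) = (t.*2 \in marked i low) := blocked_top i le.
by rewrite /blocked E1 E2 !has_cat !h !has_nseq cl !andbT !lt0b; do 2!case: (_ \in _).
Qed.

Lemma marked_head i x Y : all (leq^~ x) Y -> x \in marked i Y ->
  marked i Y = x :: behead (marked i Y).
Proof.
move=> leY; have := marked_pairwise i Y; have : all (leq^~ x) (marked i Y).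
  by apply/allP => y /marked_sub /(allP leY).
case: (marked i Y) => //= y s /andP[yx _] /andP[/allP ys _]; rewrite inE => /orP[/eqP->//|xs].
have := ys _ xs; rewrite /close; move: yx; clear; case: ifP; lia.
Qed.

(** * Positions of the 2-marked parts above and below a level *)

Section Pmark.
Variables (pi T V : seq nat).
Hypothesis markE : marked 2 pi = rev T ++ V.

Lemma pmark_rev j : 0 < j -> pmark 2 pi j =
  if j <= size T then Fin (nth 0 T (size T - j))
  else if j - size T <= size V then Fin (nth 0 V (j - size T).-1) else NInf.
Proof.
case: j => // j _; rewrite /pmark /= /Nm markE size_cat size_rev nth_cat size_rev.
case: (ltnP j (size T)) => jT; first by rewrite nth_rev // (leq_trans jT) ?leq_addr.
by rewrite subSn // -ltn_subLR.
Qed.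

Lemma pmark_size : pmark 2 pi (size T) = if T is x :: _ then Fin x else PInf.
Proof.
by case: T pmark_rev => // x T'; rewrite /= => -> //; rewrite leqnn subnn.
Qed.

Lemma pmark_sizeS : pmark 2 pi (size T).+1 = if V is x :: _ then Fin x else NInf.
Proof. by rewrite pmark_rev // ltnn subSnn; case: V. Qed.

Lemma pmark_split v p : all (leq v.+1) T -> all (ltn^~ v) V ->
  (ext_lt_nat (pmark 2 pi p.+1) v /\ nat_lt_ext v (pmark 2 pi p)) <-> p = size T.
Proof.
move=> /allP vT /allP vV; split=> [[]|->]; last first.
  rewrite pmark_size pmark_sizeS; split.
    by case: V vV => //= x V' vV; apply: vV; rewrite mem_head.
  by case: T vT => //= x T' vT; apply: vT; rewrite mem_head.
rewrite pmark_rev //; case: (ltngtP p (size T)) => //= pT.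
  have /vT /= : nth 0 T (size T - p.+1) \in T by rewrite mem_nth // ltn_subrL (leq_ltn_trans _ pT).
  by clear; lia.
move=> _; rewrite pmark_rev; last exact: leq_ltn_trans pT.
rewrite leqNgt pT /=; case: leqP => //= pV.
have /vV /= : nth 0 V (p - size T).-1 \in V by rewrite mem_nth // prednK ?subn_gt0.
by clear; lia.
Qed.

End Pmark.

Lemma num2_flags b1 b2 h : ~~ (b1 && b2) -> (b1 || b2 -> evenrun h) ->
  num2 b1 b2 h = num2 false false h.
Proof. by case: b1; case: b2 => //= _ /(_ isT)/evenrun_num2[]. Qed.

(** Condition (2) fixes p as the actual number of 2-marked parts above 2t+1; once (3) and (4) give
    the parity, [num2_flags] replaces it by the count from the free state. *)
Lemma Cless_evens k r p t h low (b1 := t.*2 \in marked 1 low) (b2 := t.*2 \in marked 2 low) :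
  all (leq^~ t.*2) low -> all (leq 1) low ->
  Cless k r p t (evens t.+1 h ++ low) <->
  [/\ inC k r (evens t.+1 h ++ low), ~~ (b1 && b2), b1 || b2 -> evenrun h &
      num2 false false h = p].
Proof.
move=> le pos; set pi := _ ++ _.
have ltY : all (ltn^~ t.+1.*2) low by apply: sub_all le => y /=; rewrite doubleS; clear; lia.
have mE : marked 2 pi = rev (twos t.+1 b1 b2 h) ++ marked 2 low.
  by rewrite /pi marked2_evens // !blocked_top.
have sT : size (twos t.+1 b1 b2 h) = num2 b1 b2 h := size_twos _ _ _ _.
have odds x : x \in pi -> odd x -> x < 2 * t + 1.
  rewrite mem_cat => /orP[/mem_evens/andP[/negbTE->]//|/(allP le)] /= xt _.
  by move: xt; clear; lia.
have split2 : (ext_lt_nat (pmark 2 pi p.+1) (2 * t + 1) /\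
   nat_lt_ext (2 * t + 1) (pmark 2 pi p)) <-> p = num2 b1 b2 h.
  rewrite -sT; apply: pmark_split mE _ _ _ _.
    by apply/allP => y /mem_twos /=; rewrite doubleS; clear; lia.
  by apply/allP => y /marked_sub /(allP le) /=; clear; lia.
(* A 2-marked 2t has index p+1, and [type_at] gives s_0 or s_1 exactly when it has no 1-marked copy
   and the run above is even. *)
have cond4 : p = num2 b1 b2 h ->
  (pmark 2 pi p.+1 = Fin (2 * t) -> has_type pi p.+1 s_0 \/ has_type pi p.+1 s_1) <->
  (b2 -> ~~ b1 && evenrun h).
  move=> ->; rewrite -sT (pmark_sizeS mE) sT mul2n; split=> H.
    move=> B2; have EY := marked_head le B2.
    have t0 : 0 < t by rewrite -double_gt0; apply: (allP pos); apply: marked_sub B2.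
    have ht s := has_type_evens h s t0 le EY.
    rewrite -/pi -/b1 in ht; rewrite B2 in H; case: H; first by rewrite EY.
      by move=> /ht; rewrite /type_at -/b1; case: (b1); case: (evenrun h) => //; case: ifP.
    by move=> /ht; rewrite /type_at -/b1; case: (b1); case: (evenrun h) => //; case: ifP.
  case Em: (marked 2 low) => [|x L] // -[xt].
  have B2 : b2 by rewrite /b2 Em xt mem_head.
  have EY := marked_head le B2.
  have t0 : 0 < t by rewrite -double_gt0; apply: (allP pos); apply: marked_sub B2.
  have ht s := has_type_evens h s t0 le EY.
  rewrite -/pi -/b1 in ht; rewrite B2; have /andP[nb1 er] := H B2.
  rewrite !ht /type_at -/b1 (negbTE nb1) er; case: ifP; [by left|by right].
(* If 2t has no mark 1, a 2-marked 2t+2 has a 1-marked copy and type s_3. If it has mark 1, then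
   2t+2 is 2-marked as soon as it occurs, and type s_2 means that the run above 2t+2 is odd, so that
   the whole run is even. *)
have cond3 : p = num2 b1 b2 h -> ~~ (b1 && b2) ->
  (pmark 2 pi p = Fin (2 * t + 2) -> has_type pi p s_2 \/ has_type pi p s_3) <->
  (b1 -> evenrun h).
  move=> -> nb; rewrite -sT (pmark_size mE) mul2n addn2 -doubleS.
  case Eh: h => [|c h'] /=; first by split.
  case m2: (mark2 b1 b2 c) => /=; last first.
    split=> [_ B1|_]; last first.
      case ET: twos => [|x T'] // -[xt].
      have := @mem_twos t.+2 (mark1 b1 c) false h' x; rewrite ET mem_head xt => /(_ isT).
      by rewrite !doubleS; clear; lia.
    by move: m2 nb; rewrite /mark2 B1; case: (b2) => //=; case: eqP.
  rewrite size_twos.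
  pose Y := nseq c t.+1.*2 ++ low.
  have [E1 E2] := marked_nseq c t.+1 low.
  rewrite -/Y !blocked_top // -/b1 -/b2 m2 in E1 E2.
  have leY : all (leq^~ t.+1.*2) Y.
    by rewrite all_cat all_nseq leqnn orbT; apply: sub_all ltY => y; apply: ltnW.
  have n1 : (t.+1.*2 \in marked 1 Y) = mark1 b1 c.
    rewrite E1 mem_cat mem_nseq eqxx andbT lt0b; case: (boolP (_ \in marked 1 low)).
      by move/marked_sub/(allP ltY); rewrite /= ltnn.
    by rewrite orbF.
  have ht s := has_type_evens h' s (ltn0Sn t) leY E2.
  have piE : pi = evens t.+2 h' ++ Y by rewrite /pi Eh /= -catA.
  rewrite -piE n1 in ht.
  rewrite !ht /type_at n1; move: m2; rewrite /mark1 /mark2.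
  case: (b2) => //=; case: (b1) => /=; case: (c) => [|[|c']] //= _.
  + split=> [/(_ erefl)|/(_ isT)]; first by case: (evenrun h') => //; case: ifP => _ [].
    by move/negbTE=> -> _; left.
  + split=> [/(_ erefl)|/(_ isT)]; first by case: (evenrun h') => //; case: ifP => _ [].
    by move/negbTE=> -> _; left.
  + by split=> // _ _; right.
split.
  case=> inCp [_ [/split2 pE [c3 c4]]].
  have B4 := (cond4 pE).1 c4; have nb : ~~ (b1 && b2).
    by apply/negP => /andP[B1 /B4]; rewrite B1.
  have B3 := (cond3 pE nb).1 c3.
  have er : b1 || b2 -> evenrun h by case/orP => [/B3|/B4/andP[]].
  by split=> //; rewrite pE num2_flags.
case=> inCp nb er pE; have pE' : p = num2 b1 b2 h by rewrite num2_flags.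
split=> //; split=> //; split; first exact/split2.
split.
  by apply/(cond3 pE' nb) => B1; apply: er; rewrite B1.
apply/(cond4 pE') => B2; rewrite er ?B2 ?orbT // andbT.
by move: nb; rewrite B2 andbT.
Qed.

Lemma gg_cat s Y : exists2 u, gg (s ++ Y) = u ++ gg Y & size u = size s.
Proof.
elim: s => [|x s [u E su]]; first by exists [::].
by rewrite /= E; exists (mex_pos [seq q.2 | q <- zip (s ++ Y) (u ++ gg Y) & close x q.1] :: u); rewrite //= su.
Qed.

Lemma odd_top_mark t h low : all (leq^~ t.*2) low ->
  (forall j, j < size (evens t.+1 h ++ t.*2.+1 :: low) ->
     nth 0 (evens t.+1 h ++ t.*2.+1 :: low) j = t.*2.+1 ->
     nth 0 (gg (evens t.+1 h ++ t.*2.+1 :: low)) j <= 2) <->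
  ~~ ((t.*2 \in marked 1 low) && (t.*2 \in marked 2 low)).
Proof.
move=> le; have [u Eu su] := gg_cat (evens t.+1 h) (t.*2.+1 :: low).
rewrite {}Eu; set m := mex_pos [seq q.2 | q <- zip low (gg low) & close t.*2.+1 q.1].
have -> : gg (t.*2.+1 :: low) = m :: gg low by [].
have m12 : (m <= 2) = ~~ ((t.*2 \in marked 1 low) && (t.*2 \in marked 2 low)).
  have := mex_pos1 [seq q.2 | q <- zip low (gg low) & close t.*2.+1 q.1].
  have := mex_pos2 [seq q.2 | q <- zip low (gg low) & close t.*2.+1 q.1].
  rewrite !mem_close_marks !close_odd_top // -/m.
  have : 0 < m by [].
  by case: (m) => [|[|[|m']]] // _; do 2!case: (_ \in _).
rewrite -m12; split=> [H|m2 j].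
  have := H (size (evens t.+1 h)); rewrite size_cat /= addnS ltnS leq_addr.
  by rewrite !nth_cat ltnn su ltnn subnn /=; apply.
rewrite size_cat !nth_cat su; case: (ltnP j (size (evens t.+1 h))) => jh jn.
  by move=> E; have := mem_nth 0 jh; rewrite E => /mem_evens; rewrite /= odd_double.
case E: (j - size (evens t.+1 h)) => [|i] //= ni.
have /(allP le) /= : nth 0 low i \in low.
  by apply: mem_nth; move: jn E jh; rewrite /=; clear; lia.
by rewrite ni ltnn.
Qed.

Lemma nth_rev_cat (T V : seq nat) j : j < size T ->
  nth 0 (rev T ++ V) (size T - j.+1) = nth 0 T j.
Proof.
move=> jT; have lt : size T - j.+1 < size T by rewrite ltn_subrL (leq_ltn_trans _ jT).
by rewrite nth_cat size_rev lt nth_rev // subnSK // subKn // ltnW.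
Qed.

Section OddTop.
Variables (k r p t : nat) (h low : seq nat).
Let b1 := t.*2 \in marked 1 low.
Let b2 := t.*2 \in marked 2 low.
Let X := t.*2.+1 :: low.
Let pi := evens t.+1 h ++ X.
Let T := twos t.+1 true (b1 || b2) h.
Let V := marked 2 X.
Hypothesis le : all (leq^~ t.*2) low.

Let ltX : all (ltn^~ t.+1.*2) X.
Proof. by rewrite /= doubleS ltnSn; apply: sub_all le => y /=; clear; lia. Qed.

Let mE : marked 2 pi = rev T ++ V.
Proof. by rewrite /pi marked2_evens //; have [-> ->] := blocked_odd_top le. Qed.

Let ltV : all (ltn^~ t.+1.*2) V.
Proof. by apply/allP => x /marked_sub /(allP ltX). Qed.

Let geT : all (leq t.+1.*2) T.
Proof. by apply/allP => x /mem_twos. Qed.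

Let T_low j : j < size T -> nth 0 T j <= t.+1.*2 -> j = 0 /\ nth 0 T 0 = t.+1.*2.
Proof.
move=> jT H; rewrite size_twos in jT; have := nth_twos_ge t.+1 jT.
have [j0|j0] := posnP j; last by move: H j0; rewrite -/T; clear; lia.
by move: H; rewrite j0 -/T; clear; lia.
Qed.

Let pmark_eq j : pmark 2 pi j = Fin t.+1.*2 -> j = size T /\ nth 0 T 0 = t.+1.*2.
Proof.
case: j => // j; rewrite (pmark_rev mE) //; case: ltnP => jT.
  case=> E; have lt : size T - j.+1 < size T by rewrite ltn_subrL (leq_ltn_trans _ jT).
  have [|j0 ->] := T_low lt; first by rewrite E.
  by split=> //; move: j0 jT; clear; lia.
case: leqP => // jV [E]; have /(allP ltV) /= : nth 0 V (j.+1 - size T).-1 \in V.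
  by rewrite mem_nth // prednK ?subn_gt0.
by rewrite E ltnn.
Qed.

(** A 2-marked part 2t+2 satisfies both inequalities of condition (3), which therefore leaves two
    candidates for p. *)
Let between : nat_le_ext t.+1.*2 (pmark 2 pi p) /\ ext_le_nat (pmark 2 pi p.+1) t.+1.*2 <->
  p = size T \/ p.+1 = size T /\ nth 0 T 0 = t.+1.*2.
Proof.
split.
  case; rewrite (pmark_rev mE (ltn0Sn p)); case: (ltngtP p (size T)) => [pT|pT|->]; last by left.
    move=> _ /= H; have lt : size T - p.+1 < size T by rewrite ltn_subrL (leq_ltn_trans _ pT).
    have [j0 ->] := T_low lt H; right; split=> //.
    by move: j0 pT; clear; lia.
  rewrite (pmark_rev mE); last exact: leq_ltn_trans pT.
  rewrite leqNgt pT /=; case: leqP => //= pV.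
  have /(allP ltV) /= : nth 0 V (p - size T).-1 \in V by rewrite mem_nth // prednK ?subn_gt0.
  by rewrite ltnNge => /negbTE ->.
case=> [->|[pT H]].
  rewrite (pmark_size mE) (pmark_sizeS mE); split.
    by case: (T) geT => //= x s /andP[].
  by case: (V) ltV => //= x s /andP[/ltnW].
split; last by rewrite pT (pmark_size mE); case: (T) pT H => //= x s _ ->.
case: (posnP p) => [->//|p0]; rewrite (pmark_rev mE) // -pT leqnSn /=.
by apply: (allP geT); rewrite mem_nth // subSnn -pT ltnS.
Qed.


Let count_pi j : count_mem (t.+1 + j).*2 pi = nth 0 h j.
Proof.
rewrite count_cat count_evens ltnNge leq_addr /= addKn.
have -> : t.*2.+1 == (t.+1 + j).*2 = false by apply/eqP; clear; lia.
rewrite (_ : count _ low = 0) ?addn0 //; apply: count_over le _; clear; lia.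
Qed.

Let mem_pi j : ((t.+1 + j).*2 \in pi) = (nth 0 h j != 0).
Proof. by rewrite -has_pred1 has_count count_pi lt0n. Qed.

(** If 2t carries mark 1 or 2, then 2t+2 gets neither: (4) and (5) are void and (6) expresses
    thickness through [twos_gap]. If 2t carries neither, then 2t+1 has mark 1 and 2t+2, when it
    occurs, has mark 2 and type s_0 or s_2; now (6) is void, and (4) or (5) chooses between the two
    candidates for p. *)
Lemma Ceq_evens : Ceq k r p t pi <->
  [/\ inC k r pi, ~~ (b1 && b2), thick (~~ (b1 || b2)) h = (b1 || b2) & num2 false false h = p].
Proof.
have odds : t.*2.+1 \in pi /\ (forall x, x \in pi -> odd x -> x <= t.*2.+1).
  split; first by rewrite mem_cat mem_head orbT.
  move=> x; rewrite mem_cat inE => /orP[/mem_evens/andP[/negbTE->]//|/orP[/eqP->//|]].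
  by move/(allP le) => /= xt _; apply: leqW.
suff main : ~~ (b1 && b2) ->
    ((p = size T \/ p.+1 = size T /\ nth 0 T 0 = t.+1.*2) /\
     (marked2_of_type pi t.+1.*2 s_0 ->
        pmark 2 pi p.+1 = Fin t.+1.*2 /\
        exists i, 1 <= i <= p.+1 /\
          nth 0 (marked 2 pi) i.-1 = nth 0 (marked 2 pi) p + 4 * (p.+1 - i) /\
          count_mem (nth 0 (marked 2 pi) i.-1) pi = 1) /\
     (marked2_of_type pi t.+1.*2 s_2 -> pmark 2 pi p = Fin t.+1.*2) /\
     (t.+1.*2 \in pi -> t.+1.*2 \notin marked 2 pi ->
        pmark 2 pi p = Fin t.+2.*2 /\ has_type pi p s_3 /\
        exists i, 1 <= i <= p /\
          nth 0 (marked 2 pi) i.-1 = nth 0 (marked 2 pi) p.-1 + 4 * (p - i) /\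
          (nth 0 (marked 2 pi) i.-1 + 2) \notin pi)) <->
    (thick (~~ (b1 || b2)) h = (b1 || b2) /\ num2 false false h = p).
  have e4 : 2 * t + 4 = t.+2.*2 by clear; lia.
  rewrite /Ceq e4 mul2n addn1 addn2 -doubleS; split.
    case=> inCp [_ [/(odd_top_mark _ le) nb [/between bt rest]]].
    by have [? ?] := (main nb).1 (conj bt rest).
  case=> inCp nb th pE; have [bt rest] := (main nb).2 (conj th pE).
  split=> //; split=> //; split; first exact/(odd_top_mark _ le).
  by split; first exact/between.
move=> nb.
have sT : size T = num2 true (b1 || b2) h := size_twos _ _ _ _.
have [th2 th1] := num2_thick h.
have noT : nth 0 T 0 != t.+1.*2 ->
    [/\ (p = size T \/ p.+1 = size T /\ nth 0 T 0 = t.+1.*2) <-> p = size T &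
        forall s, ~ marked2_of_type pi t.+1.*2 s].
  move=> nT; split; first by split=> [[//|[_ E]]|]; [rewrite E eqxx in nT|left].
  by move=> s [j [/pmark_eq[_ E] _]]; rewrite E eqxx in nT.
have in0 := mem_pi 0; rewrite addn0 in in0.
have nth_pi j : j < size T -> nth 0 (marked 2 pi) (size T - j.+1) = nth 0 T j.
  by rewrite mE; apply: nth_rev_cat.
case e12: (b1 || b2) sT; rewrite [~~ _]/= => sT.
  have TE : T = twos t.+1 true true h by rewrite /T e12.
  have nT : nth 0 T 0 != t.+1.*2.
    case: (posnP (size T)) => [/size0nil ->//|T0].
    have := @nth_twos_ge t.+1 true true h 0; rewrite -TE -sT => /(_ T0).
    by rewrite doubleS; clear; lia.
  have [-> nm] := noT nT.
  have notL2 : t.+1.*2 \notin marked 2 pi.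
    rewrite mE mem_cat mem_rev negb_or; apply/andP; split; apply/negP.
      move=> /(nthP 0)[j jT E]; have [|_ E0] := T_low jT; first by rewrite E.
      by rewrite E0 eqxx in nT.
    by move/(allP ltV); rewrite /= ltnn.
  have [h0|] := eqVneq (nth 0 h 0) 0.
    have th : thick false h by case: (h) h0 => [|[]].
    rewrite sT th2 // th; split=> [[->]//|[_ ->]]; split=> //.
    split; first by move/nm.
    by split; [move/nm|rewrite in0 h0].
  case Eh: h => [//|[//|c] h'] _; rewrite -Eh.
  have TE' : T = twos t.+2 false false h' by rewrite TE Eh.
  have shE : thick false h = thick true h' by rewrite Eh.
  have nE : num2 true true h = num2 false false h' by rewrite Eh.
  have {}in0 : t.+1.*2 \in pi by rewrite in0 Eh.
  have at_ j : (t.+2 + j.*2).*2 + 2 \in pi = (nth 0 h' j.*2.+1 != 0).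
    rewrite (_ : _ + 2 = (t.+1 + j.*2.+2).*2); last by clear; lia.
    by rewrite mem_pi Eh.
  rewrite shE; split=> [[pT [_ [_ /(_ in0 notL2)]]]|[th pE]].
    case=> pmp [_ [i [/andP[i0 ip] [Li Ni]]]].
    have T0 : nth 0 T 0 = t.+2.*2.
      by move: pmp; rewrite pT (pmark_size mE); case: (T) => //= x T' [].
    have iE : i.-1 = size T - (p - i).+1 by move: i0 ip pT; clear; lia.
    have jT : p - i < size T by move: i0 ip pT; clear; lia.
    have pE : p.-1 = size T - 1 by rewrite pT subn1.
    have Tp : 0 < size T by apply: leq_ltn_trans jT.
    have th : thick true h'.
      apply/(twos_gap t.+2); exists (p - i); rewrite -TE' -nE -sT; split=> //.
        move: Li; rewrite iE pE !nth_pi // T0 => ->; clear; lia.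
      apply/eqP/negPn; rewrite -at_ (_ : (t.+2 + _).*2 = nth 0 (marked 2 pi) i.-1) //.
      by rewrite Li pE nth_pi // T0; clear; lia.
    by split=> //; rewrite -th2 ?shE // pT sT.
  have pT : p = size T by rewrite sT th2 ?shE.
  split=> //; split; first by move/nm.
  split; first by move/nm.
  move=> _ _; case Eh': h' th => [//|g h''] th.
  pose Y1 := nseq c.+1 t.+1.*2 ++ X; pose Y := nseq g t.+2.*2 ++ Y1.
  have [bX1 bX2] := blocked_odd_top le; rewrite e12 in bX2.
  have [B1 B2] := blocked_nseq c.+1 ltX; rewrite bX1 bX2 /= in B1 B2.
  have [E1 E2] := marked_nseq g t.+2 Y1; rewrite B1 B2 in E1 E2.
  have [g' Eg] : exists g', g = g'.+2 by move: th; case: (g) => [|[|g']] //; exists g'.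
  have n1 : t.+2.*2 \in marked 1 Y by rewrite E1 Eg mem_head.
  have leY : all (leq^~ t.+2.*2) Y.
    rewrite !all_cat !all_nseq leqnn !doubleS; apply/and3P; split; first by rewrite orbT.
      by rewrite (leq_trans (leqnSn _)) ?orbT.
    by apply: sub_all ltX => x /=; rewrite !doubleS; clear; lia.
  have piE : pi = evens t.+3 h'' ++ Y by rewrite /pi Eh Eh' /= -!catA.
  rewrite {2}Eg in E2.
  have ht := has_type_evens h'' s_3 (ltn0Sn t.+1) leY E2.
  rewrite -piE n1 /type_at n1 in ht.
  have T1 : T = t.+2.*2 :: twos t.+3 true true h'' by rewrite TE' Eh' Eg.
  split; first by rewrite pT (pmark_size mE) T1.
  split; first by rewrite pT T1 /= size_twos; apply/ht.
  have [j [jn Ej gap]] := (twos_gap t.+2 h').2 (etrans (congr1 _ Eh') th).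
  rewrite -TE' -nE -sT in jn Ej.
  (* [twos] increases from index 0, the 2-marked parts decrease from index 1, whence this index. *)
  exists (size T - j); rewrite pT subn_gt0 jn leq_subr; split=> //.
  have iE : (size T - j).-1 = size T - j.+1 by rewrite subnS.
  have pE' : (size T).-1 = size T - 1 by rewrite subn1.
  rewrite iE pE' !nth_pi ?(leq_ltn_trans _ jn) // Ej at_ gap; split=> //.
  by rewrite subKn ?(ltnW jn) // T1 /=; clear; lia.
have [B1 B2] := norP (negbT e12).
have TE : T = twos t.+1 true false h by rewrite /T e12.
have [h0|] := eqVneq (nth 0 h 0) 0.
  have th : thick true h = false by case: (h) h0 => [|[]].
  have nE : num2 true false h = num2 false false h by case: (h) h0 => [|[]].
  have nT : nth 0 T 0 != t.+1.*2.
    case: (posnP (size T)) => [/size0nil ->//|T0].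
    rewrite TE in T0 *; case: (h) h0 T0 => [|[|c] h'] //= _; rewrite size_twos => T0.
    apply/eqP => E; have := @nth_twos_ge t.+2 false false h' 0 T0.
    by rewrite [nth _ _ _]E; clear; lia.
  have [-> nm] := noT nT.
  rewrite sT nE th; split=> [[->]//|[_ ->]]; split=> //.
  split; first by move/nm.
  by split; [move/nm|rewrite in0 h0].
case Eh: h => [//|[//|c] h'] _; rewrite -Eh.
have T1 : T = t.+1.*2 :: twos t.+2 false true h' by rewrite TE Eh.
pose Y := nseq c.+1 t.+1.*2 ++ X.
have [bX1 bX2] := blocked_odd_top le; rewrite -/b1 -/b2 e12 in bX2.
have [E1 E2] := marked_nseq c.+1 t.+1 X; rewrite bX1 bX2 /= in E1 E2.
have [M1 _] := marked_odd_top le; rewrite -/b1 B1 /= in M1.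
have n1 : t.+1.*2 \in marked 1 Y = false.
  by rewrite E1; apply/negP => /marked_sub /(allP ltX); rewrite /= ltnn.
have leY : all (leq^~ t.+1.*2) Y.
  rewrite all_cat all_nseq leqnn orbT /=; apply/andP; split; first by rewrite doubleS leqW.
  by apply: sub_all le => x /=; rewrite doubleS => xt; rewrite !leqW.
have piE : pi = evens t.+2 h' ++ Y by rewrite /pi Eh /= -!catA.
have ht s := has_type_evens h' s (ltn0Sn t) leY E2.
have tyE : type_at t.+1 h' Y = if evenrun h' then s_0 else s_2.
  by rewrite /type_at n1 doubleS subn1 E1 M1 mem_head.
have sT' : size T = (num2 false true h').+1 by rewrite T1 /= size_twos.
rewrite -piE n1 tyE in ht; rewrite -sT' in ht.
have m2 s : marked2_of_type pi t.+1.*2 s <-> (if evenrun h' then s_0 else s_2) = s.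
  split=> [[j [/pmark_eq[-> _] /ht]]//|/ht H].
  by exists (size T); split; rewrite // (pmark_size mE) T1.
have inL2 : t.+1.*2 \in marked 2 pi by rewrite mE mem_cat mem_rev T1 mem_head.
have pmT : pmark 2 pi (size T) = Fin t.+1.*2 by rewrite (pmark_size mE) T1.
have T0 : nth 0 T 0 = t.+1.*2 by rewrite T1.
have Tp : 0 < size T by rewrite sT'.
have eE : evenrun h = ~~ evenrun h' by rewrite Eh.
have nE : ~~ thick true h -> size T = num2 false false h + evenrun h'.
  by move=> nth_; rewrite sT num2_swap th1 // eE negbK.
(* By [nE], the count from the free state is one less than [size T] for type s_0 and equal to it for
   type s_2, as (4) and (5) demand. In the second case the run is even, so it is never
   [thick true]. *)
case ev: (evenrun h') in eE nE m2.
  split=> [[_ [/(_ ((m2 _).2 erefl)) [/pmark_eq[pE _]] [i [/andP[i0 ip] [Li Ci]]] _]]|[th pE]].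
    have iE : i.-1 = size T - (p.+1 - i).+1 by rewrite -pE; move: i0 ip; clear; lia.
    have jT : p.+1 - i < size T by rewrite -pE; move: i0 ip; clear; lia.
    have pE' : nth 0 (marked 2 pi) p = t.+1.*2.
      by rewrite (_ : p = size T - 1) ?nth_pi // -pE subn1.
    have LE : nth 0 T (p.+1 - i) = (t.+1 + (p.+1 - i).*2).*2.
      by rewrite -nth_pi // -iE Li pE'; clear; lia.
    have C1 : nth 0 h (p.+1 - i).*2 = 1 by rewrite -count_pi -LE -nth_pi // -iE.
    have th : thick true h = false.
      apply/negP => th; have := @twos_thick_not_one t.+1 h (p.+1 - i) th.
      by rewrite -TE C1 -(size_twos t.+1) -TE => /(_ jT LE).
    split=> //; have := nE (negbT th); rewrite -pE; clear; lia.
  have pT : p.+1 = size T by rewrite nE ?th // pE addn1.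
  split; first by right.
  split; last by split; [move/m2|rewrite inL2].
  move=> _; rewrite pT; split=> //.
  have [j [jn Ej hj]] := twos_one t.+1 (negbT eE) (negbT th).
  rewrite -TE -sT in jn Ej.
  exists (size T - j); rewrite subn_gt0 jn leq_subr -subnS nth_pi // subKn ?(ltnW jn) //.
  rewrite Ej count_pi hj; split=> //; split=> //.
  rewrite (_ : p = size T - 1) ?nth_pi // ?T0 -?pT ?subn1 //.
  by clear; lia.
have th : thick true h = false by apply/negbTE/evenrun_nthick; rewrite eE.
have pT : size T = num2 false false h by rewrite nE ?th // addn0.
rewrite th -pT; split=> [[_ [_ [/(_ ((m2 _).2 erefl))/pmark_eq[-> _] _]]]//|[_ <-]].
split; first by left.
by split; [move/m2|split=> //; rewrite inL2].
Qed.

End OddTop.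

Lemma evens_pad a h n : evens a (h ++ nseq n 0) = evens a h.
Proof.
elim: h a => [|c h IH] a /=; last by rewrite IH.
by elim: n a => //= n IH a; rewrite IH.
Qed.

(** Multiplicity sequences are unique only up to trailing zeros; [shift_pad] makes this harmless for
    [insertion]. *)
Lemma evens_eq a h1 h2 : evens a h1 = evens a h2 ->
  h1 ++ nseq (size h2) 0 = h2 ++ nseq (size h1) 0.
Proof.
move=> E; have En j : nth 0 h1 j = nth 0 h2 j.
  have := count_evens a h2 (a + j); rewrite -E count_evens ltnNge leq_addr /=.
  by rewrite addKn.
have pad h n j : nth 0 (h ++ nseq n 0) j = nth 0 h j.
  by rewrite nth_cat nth_nseq if_same; case: ltnP => // /(nth_default 0) ->.
apply: (@eq_from_nth _ 0); first by rewrite !size_cat !size_nseq addnC.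
by move=> j _; rewrite !pad.
Qed.

(** * The bijection *)

Definition insertion (t : nat) (pi om : seq nat) : Prop :=
  exists low h h', [/\ all (leq^~ t.*2) low, pi = evens t.+1 h ++ low,
    om = evens t.+1 h' ++ t.*2.+1 :: low &
    shift ((t.*2 \in marked 1 low) || (t.*2 \in marked 2 low)) h h'].

Lemma filter_evens a h low : all (ltn^~ a.*2) low ->
  [seq x <- evens a h ++ low | x < a.*2] = low.
Proof.
move=> lt; rewrite filter_cat (all_filterP lt) -[RHS]cat0s; congr (_ ++ _).
apply/eqP; rewrite -[_ == _]negbK -has_filter; apply/hasPn => x /mem_evens/andP[_].
by rewrite leqNgt.
Qed.

Lemma evens_cat_inj a h1 h2 low1 low2 :
  all (ltn^~ a.*2) low1 -> all (ltn^~ a.*2) low2 ->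
  evens a h1 ++ low1 = evens a h2 ++ low2 -> evens a h1 = evens a h2 /\ low1 = low2.
Proof.
move=> lt1 lt2 E; have El : low1 = low2.
  by rewrite -(filter_evens h1 lt1) E filter_evens.
have Es : size (evens a h1) = size (evens a h2).
  by have := congr1 size E; rewrite El !size_cat => /addIn.
by move/eqP: E; rewrite eqseq_cat // => /andP[/eqP].
Qed.

Lemma insertion_fun t pi om1 om2 : insertion t pi om1 -> insertion t pi om2 -> om1 = om2.
Proof.
case=> low [h1 [h1' [le1 -> -> s1]]] [low2 [h2 [h2' [le2 E -> s2]]]].
have lt u : all (leq^~ t.*2) u -> all (ltn^~ t.+1.*2) u.
  by apply: sub_all => x /=; rewrite doubleS; clear; lia.
have [Eh El] := evens_cat_inj (lt _ le1) (lt _ le2) E; rewrite -El in s2 *.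
have := shift_pad (size h2) s1; rewrite (evens_eq Eh) => s1'.
have := shift_fun s1' (shift_pad (size h1) s2) => E'.
by rewrite -(evens_pad _ h1' (size h2)) E' evens_pad.
Qed.

Lemma insertion_inj t pi1 pi2 om : insertion t pi1 om -> insertion t pi2 om -> pi1 = pi2.
Proof.
case=> low [h1 [h1' [le1 -> -> s1]]] [low2 [h2 [h2' [le2 -> E s2]]]].
have lt u : all (leq^~ t.*2) u -> all (ltn^~ t.+1.*2) (t.*2.+1 :: u).
  by move=> le; rewrite /= doubleS ltnSn; apply: sub_all le => x /=; clear; lia.
have [Eh [El]] := evens_cat_inj (lt _ le1) (lt _ le2) E; rewrite -El in s2 *.
have := shift_pad (size h2') s1; rewrite (evens_eq Eh) => s1'.
have := shift_inj s1' (shift_pad (size h1') s2) => E'.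
by rewrite -(evens_pad _ h1 (size h2')) E' evens_pad.
Qed.

Lemma Cless_decomp k r p t pi : Cless k r p t pi ->
  exists h low, [/\ pi = evens t.+1 h ++ low, all (leq^~ t.*2) low & all (leq 1) low].
Proof.
case=> -[/andP[ss pos] _] [odds _].
have [|h E] := @evens_decomp t.+1 pi ss.
  move=> x xpi; rewrite doubleS => tx; apply/negP => /(odds _ xpi).
  by move: tx; clear; lia.
exists h, [seq x <- pi | x < t.+1.*2]; split=> //.
  apply/allP => x; rewrite mem_filter => /andP[xt xpi] /=.
  have [ox|ex] := boolP (odd x); first by have := odds _ xpi ox; clear; lia.
  have [xe|] := eqVneq x t.*2.+1; first by rewrite xe /= odd_double in ex.
  by move: xt; clear; lia.
by apply/allP => x; rewrite mem_filter => /andP[_ /(allP pos)].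
Qed.

Lemma Ceq_decomp k r p t om : Ceq k r p t om ->
  exists h low, om = evens t.+1 h ++ t.*2.+1 :: low /\ all (leq^~ t.*2) low.
Proof.
case=> -[/andP[ss pos] [od _]] [[top odds] _].
rewrite mul2n addn1 in top odds.
have [|h E] := @evens_decomp t.+1 om ss.
  move=> x xpi; rewrite doubleS => tx; apply/negP => /(odds _ xpi).
  by move: tx; clear; lia.
set X := [seq x <- om | _] in E.
have sX : sorted geq X by apply: sorted_filter => //; exact: geq_trans.
have leX : all (leq^~ t.*2.+1) X.
  by apply/allP => x; rewrite mem_filter doubleS ltnS => /andP[].
have c1 : count_mem t.*2.+1 X = 1.
  have o : odd t.*2.+1 by rewrite /= odd_double.
  apply/eqP; rewrite eqn_leq -has_count has_pred1 mem_filter doubleS ltnSn top /= andbT.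
  by have := od _ o; rewrite E count_cat count_evens_odd.
exists h, [seq y <- X | y < t.*2.+1]; split; last exact: filter_all.
by rewrite {1}E {1}(sorted_top sX leX) c1.
Qed.

Lemma insertion_total k r p t pi : 3 <= r -> r <= k -> Cless k r p t pi ->
  exists om, insertion t pi om /\ Ceq k r p t om.
Proof.
move=> r3 rk C; have [h [low [E le pos]]] := Cless_decomp C; rewrite {}E in C *.
have E0 : evens t.+1 (rcons h 0) = evens t.+1 h by rewrite -cats1 (evens_pad _ _ 1).
have [_ nb er _] := (Cless_evens k r p h le pos).1 C.
have [h' sh] := shift_total (introT implyP er).
rewrite -E0 in C *; have [inCp _ _ pE] := (Cless_evens k r p _ le pos).1 C.
exists (evens t.+1 h' ++ t.*2.+1 :: low); split; first by exists low, (rcons h 0), h'.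
apply/(Ceq_evens _ _ _ _ le); split=> //.
- have [B L cp] := (inC_even_top _ r3 rk le).1 inCp.
  have lb := load_bound r3 rk B nb.
  apply/(inC_odd_top _ r3 rk le); split=> //; first exact: leq_ltn_trans (leq_addr _ _) lb.
  rewrite -(shift_cap _ sh) ?leq_subr //; last by move: lb; clear; lia.
  by move: r3 rk; clear; lia.
- exact: shift_thick sh.
- by rewrite (shift_num2 sh).
Qed.

Lemma insertion_onto k r p t om : 3 <= r -> r <= k -> Ceq k r p t om ->
  exists pi, insertion t pi om /\ Cless k r p t pi.
Proof.
move=> r3 rk C; have [h' [low [E le]]] := Ceq_decomp C; rewrite {}E in C *.
have [inCo nb th pE] := (Ceq_evens _ _ _ _ le).1 C.
have [h sh] := shift_onto th.
exists (evens t.+1 h ++ low); split; first by exists low, h, h'.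
have [B L cp] := (inC_odd_top _ r3 rk le).1 inCo.
have [_ pos _ _ _] := B.
apply/(Cless_evens _ _ _ _ le pos); split=> //.
- have lb := load_bound r3 rk B nb.
  apply/(inC_even_top _ r3 rk le); split=> //; first exact: ltnW.
  rewrite (shift_cap _ sh) ?leq_subr //; last by move: lb; clear; lia.
  by move: r3 rk; clear; lia.
- exact: shift_evenrun sh.
- by rewrite -(shift_num2 sh).
Qed.

Lemma insertion_size k r p t pi om : Cless k r p t pi -> insertion t pi om ->
  sumn om = sumn pi + 2 * (p + t) + 1 /\ size om = (size pi).+1.
Proof.
move=> C [low [h [h' [le E -> sh]]]]; rewrite E in C *.
have pos : all (leq 1) low.
  by case: C => -[/andP[_]]; rewrite all_cat => /andP[].
have [_ _ _ <-] := (Cless_evens k r p h le pos).1 C.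
rewrite !sumn_cat !size_cat !sumn_evens !size_evens (shift_weight _ sh) (shift_sum sh) /=.
by split; clear; lia.
Qed.

(** Raising t by n lowers p by n, so n of the 2-marked parts above 2t+1 would have to lie below
    2t'+1. Gaps of at least 4 leave only n = 1 and the part 2t+2, whose type would be s_2 or s_3 by
    (3) for t and s_0 or s_1 by (4) for t'. *)
Lemma Cless_unique k r p t p' t' pi :
  Cless k r p t pi -> Cless k r p' t' pi -> p + t = p' + t' -> t = t'.
Proof.
wlog lt : p t p' t' / t < t'.
  move=> H C C' E; case: (ltngtP t t') => // tt; first exact: H C C' E.
  by apply/esym; apply: H C' C (esym E).
move=> C C' E; have [h [low [Epi le pos]]] := Cless_decomp C.
set b1 := t.*2 \in marked 1 low; set b2 := t.*2 \in marked 2 low.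
have [_ nb er pE] : [/\ True, ~~ (b1 && b2), b1 || b2 -> evenrun h & num2 false false h = p].
  by move: C; rewrite Epi => /(Cless_evens k r p h le pos)[].
have ltY : all (ltn^~ t.+1.*2) low by apply: sub_all le => y /=; rewrite doubleS; clear; lia.
have mE : marked 2 pi = rev (twos t.+1 b1 b2 h) ++ marked 2 low.
  by rewrite Epi marked2_evens // !blocked_top.
have sT : size (twos t.+1 b1 b2 h) = p by rewrite size_twos num2_flags.
have p'p : p' < p by move: E lt; clear; lia.
have pm := pmark_rev mE (ltn0Sn p'); rewrite sT p'p in pm.
have jn : p - p'.+1 < num2 b1 b2 h by rewrite num2_flags // pE; move: p'p; clear; lia.
have ge := nth_twos_ge t.+1 jn.
case: C => _ [_ [_ [c3 _]]]; case: C' => _ [_ [[lt' _] [_ c4]]].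
rewrite pm /= in lt'.
have t'E : t' = t.+1 by move: ge lt' E lt; clear; case: b2 => /=; lia.
have pp : p = p'.+1 by move: E t'E; clear; lia.
have x0 : nth 0 (twos t.+1 b1 b2 h) (p - p'.+1) = 2 * t'.
  by move: ge lt'; rewrite t'E; clear; lia.
rewrite x0 -pp in pm.
have e2 : 2 * t + 2 = 2 * t' by rewrite t'E; clear; lia.
rewrite e2 in c3; rewrite -pp in c4.
by case: (c3 pm) => -[_ e3]; case: (c4 pm) => -[_]; rewrite e3.
Qed.

Theorem theorem5p6 (k r m : nat) :
  3 <= r -> r <= k ->
  exists Phi : seq nat -> seq nat,
    (forall pi, Cless_m k r m pi -> Ceq_m k r m (Phi pi)) /\
    (forall pi1 pi2, Cless_m k r m pi1 -> Cless_m k r m pi2 ->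
       Phi pi1 = Phi pi2 -> pi1 = pi2) /\
    (forall om, Ceq_m k r m om -> exists2 pi, Cless_m k r m pi & Phi pi = om) /\
    (forall pi, Cless_m k r m pi ->
       sumn (Phi pi) = sumn pi + 2 * m + 1 /\ size (Phi pi) = (size pi).+1).
Proof.
move=> r3 rk.
(* [R] does not fix p and t; [Cless_unique] recovers them from the source, and the largest odd part
   recovers t from the image. *)
pose R pi om := exists p t, [/\ p + t = m, Cless k r p t pi, Ceq k r p t om & insertion t pi om].
pose Phi pi := epsilon (inhabits [::]) (R pi).
have PhiP pi : Cless_m k r m pi -> R pi (Phi pi).
  case=> p [t [ptm C]]; apply: epsilon_spec.
  by have [om [L C']] := insertion_total r3 rk C; exists om, p, t.
exists Phi; split.
  by move=> pi /PhiP[p [t [ptm _ C _]]]; exists p, t.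
split.
  move=> pi1 pi2 /PhiP[p1 [t1 [_ _ C1 L1]]] /PhiP[p2 [t2 [_ _ C2 L2]]] E.
  rewrite -E in C2 L2; suff t12 : t1 = t2 by rewrite -t12 in L2; exact: insertion_inj L1 L2.
  case: C1 C2 => _ [[in1 le1] _] [_ [[in2 le2] _]].
  have o t : odd (2 * t + 1) by rewrite mul2n addn1 /= odd_double.
  by have := le1 _ in2 (o t2); have := le2 _ in1 (o t1); clear; lia.
split.
  move=> om [p [t [ptm C]]]; have [pi [L C']] := insertion_onto r3 rk C.
  have Cm : Cless_m k r m pi by exists p, t.
  exists pi => //; have [p' [t' [ptm' Cp _ L']]] := PhiP _ Cm.
  have t12 := Cless_unique C' Cp (etrans ptm (esym ptm')).
  by rewrite -t12 in L'; apply: insertion_fun L' L.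
move=> pi /PhiP[p [t [<- C _ L]]]; exact: insertion_size C L.
Qed.
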